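(* The following hold. (i) There is an absolute constant $C$ such that for all integers $k \ge 4$ and $n \ge 6$, $$\mathrm{sat}^*(n,K_k) \le \left(\frac14+\frac{C}{\ln k}\right)k^3 n$$ (that is, $\mathrm{sat}^*(n,K_k)\le \left(\frac14+O\left(\frac1{\ln k}\right)\right)k^3n$). (ii) For all integers $n \ge 6$, $$\mathrm{sat}^*(n,K_5) \le \left\lfloor\frac{21n}{2}\right\rfloor-48.$$
   Context: All graphs are finite and simple. An edge-colouring of a graph is proper if incident edges receive different colours, and a subgraph is rainbow if all of its edges receive pairwise distinct colours. A graph $G$ is properly rainbow $H$-saturated if (1) there is a proper edge-colouring of $G$ (with any set of colours) containing no rainbow copy of $H$, and (2) for every edge $e$ of the complement $\overline{G}$, every proper edge-colouring of $G+e$ contains a rainbow copy of $H$. The proper rainbow saturation number $\mathrm{sat}^*(n,H)$ is the minimum number of edges in an $n$-vertex properly rainbow $H$-saturated graph. *)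

(* Defs.v *)
From mathcomp Require Import all_boot.
From mathcomp Require Import boolp.

Set Implicit Arguments.
Unset Strict Implicit.
Unset Printing Implicit Defensive.

(* A simple graph on the vertex set [V] is given by its set of edges, an edge
   being a two-element set of vertices; [G + e] is then [e |: G]. *)

Definition complete_graph (V : finType) : {set {set V}} :=
  [set e : {set V} | #|e| == 2].

Definition is_graph (V : finType) (G : {set {set V}}) : bool :=
  G \subset complete_graph V.

Definition complement_graph (V : finType) (G : {set {set V}}) : {set {set V}} :=
  complete_graph V :\: G.

(* Colourings are total functions on sets of vertices, but only their values on
   the edges of the graph are ever used. *)
Definition proper_edge_colouring (V : finType) (G : {set {set V}})
    (C : Type) (c : {set V} -> C) : Prop :=
  forall e f, e \in G -> f \in G -> e != f -> ~~ [disjoint e & f] ->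
    c e <> c f.

Definition rainbow (V : finType) (F : {set {set V}})
    (C : Type) (c : {set V} -> C) : Prop :=
  {in F &, injective c}.

(* The copy of [H] given by an injection [phi] of its vertices has edge set
   [[set phi @: e | e in H]]. *)
Definition has_rainbow_copy (W V : finType) (H : {set {set W}})
    (G : {set {set V}}) (C : Type) (c : {set V} -> C) : Prop :=
  exists phi : W -> V,
    [/\ injective phi,
        [set phi @: (e : {set W}) | e in H] \subset G
      & rainbow [set phi @: (e : {set W}) | e in H] c].

Definition rainbow_saturated (W V : finType) (H : {set {set W}})
    (G : {set {set V}}) : Prop :=
  (exists (C : Type) (c : {set V} -> C),
      proper_edge_colouring G c /\ ~ has_rainbow_copy H G c) /\
  (forall e, e \in complement_graph G ->
    forall (C : Type) (c : {set V} -> C),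
      proper_edge_colouring (e |: G) c -> has_rainbow_copy H (e |: G) c).

(* [complete_graph 'I_n] is only the default value of the argmin; it is never
   used when [H] has an edge (see [rainbow_satP]). *)
Definition rainbow_sat (n : nat) (W : finType) (H : {set {set W}}) : nat :=
  #|[arg min_(G < complete_graph 'I_n
              | is_graph G && `[< rainbow_saturated H G >]) #|G| ]|.

Lemma rainbow_saturated_exists (V W : finType) (H : {set {set W}}) :
  H != set0 -> exists2 G : {set {set V}}, is_graph G & rainbow_saturated H G.
Proof.
case/set0Pn => h hH.
pose good (G : {set {set V}}) := is_graph G /\ exists (C : Type)
  (c : {set V} -> C), proper_edge_colouring G c /\ ~ has_rainbow_copy H G c.
have good0 : `[< good set0 >].
  apply/asboolP; split; first exact: sub0set.
  exists unit, (fun=> tt); split=> [e f|[phi [_ /subsetP sub _]]].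
    by rewrite inE.
  by have := sub _ (imset_f (fun e : {set W} => phi @: e) hH); rewrite inE.
case: (@arg_maxnP _ set0 (fun G => `[< good G >]) (fun G => #|G|) good0).
move=> G /asboolP [gG colG] maxG; exists G => //; split=> // e.
rewrite inE => /andP [eG eK] C c pc; apply: contrapT => noH.
have /maxG : `[< good (e |: G) >].
  apply/asboolP; split; last by exists C, c.
  by apply/subsetP=> f /setU1P [->//|/(subsetP gG)].
by rewrite cardsU1 eG /= add1n /= /geq /= ltnn.
Qed.

Lemma rainbow_satP (n : nat) (W : finType) (H : {set {set W}}) :
  H != set0 ->
  (exists G : {set {set 'I_n}},
    [/\ is_graph G, rainbow_saturated H G & #|G| = rainbow_sat n H]) /\
  (forall G : {set {set 'I_n}},
    is_graph G -> rainbow_saturated H G -> rainbow_sat n H <= #|G|).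
Proof.
move=> /(rainbow_saturated_exists 'I_n) [G0 gG0 sG0].
pose P (G : {set {set 'I_n}}) := is_graph G && `[< rainbow_saturated H G >].
have P0 : P G0 by rewrite /P gG0; apply/asboolP.
rewrite /rainbow_sat /arg_min /extremum; case: pickP => [G|none] /=.
  move=> /andP [/andP [gG /asboolP sG] /forallP minG]; split; first by exists G.
  move=> G' gG' sG'; have /implyP := minG G'; apply.
  by rewrite gG'; apply/asboolP.
case: (arg_minnP (fun G : {set {set 'I_n}} => #|G|) P0) => G PG minG.
have /negP [] := negbT (none G); apply/andP; split=> //.
by apply/forallP=> G'; apply/implyP=> /minG.
Qed.

(* Main.v *)
(* Let m be maximal such that some proper colouring of K_m has no rainbow
   K_(k-1), and join K_m completely to an independent set.  Giving private colours
   to the new edges leaves no rainbow K_k; a maximal graph with such a colouring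
   above this one is saturated.  In it every vertex v outside K_m has few outer
   neighbours: m + 1 vertices force a rainbow K_(k-1) on v and K_m, and each
   other vertex of K_m and outer neighbour of v extends it to a K_k with a
   repeated colour, which is possible for at most (k-1) C(k-2,2) < k^3/2 vertices.
   For k = 5 one has m = 6, three of the at most 12 such vertices lie in K_6 and
   v, so outer degrees are at most 9: this is the second bound.

   For the first bound it remains to see m = O(k^3 / ln k) (Alon, Lefmann and
   Roedl).  Repeated colours form a 4-uniform hypergraph in which three vertices
   lie in at most 3 edges; independent sets are rainbow cliques.  Following
   Shearer, Alon and Kostochka-Mubayi-Verstraete, choose a random sparse vertex
   set U and a uniform random independent subset W of U.  Around almost every v
   in U the hypergraph is locally sparse, and conditioning on W away from the
   links of v shows that M [v in W] + #{edges e at v with e - v in W} is at least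
   of order ln M on average, whereas its sum over v is at most M |W| + O(q |W|^3),
   q being the density of U. *)
Require Import Defs.
From mathcomp Require Import all_boot all_order all_algebra.
From mathcomp Require Import boolp reals sequences exp.
From mathcomp Require Import ring lra zify.

Set Implicit Arguments.
Unset Strict Implicit.
Unset Printing Implicit Defensive.
Import Order.TTheory GRing.Theory Num.Theory.

(** * Independent sets around a locally sparse vertex *)

Section IndependentSets.
Variables (V : finType) (E : {set {set V}}).
Implicit Types (U W S T X e : {set V}) (v : V).

Definition independent W := [forall e in E, ~~ (e \subset W)].
Definition indep_subsets U := [set W : {set V} | (W \subset U) && independent W].
(** Counts the links of [v] (edges at [v] with [v] removed) inside [W]; zero if [v] itself lies in
    an independent [W]. *)
Definition kills W v := #|[set e in E | (v \in e) && (e :\ v \subset W)]|.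
Definition link_support U v : {set V} :=
  \bigcup_(e in E | (v \in e) && (e \subset U)) (e :\ v).
(** Edges avoiding [v] cannot correlate the vertices of its links: with [W] fixed off the links,
    each link vertex is then allowed or forbidden on its own. *)
Definition locally_sparse U v :=
  [forall e in E, (e \subset U) && (v \notin e) ==>
    (#|e :&: link_support U v| <= 1)].

Lemma independentP W :
  reflect (forall e, e \in E -> e \subset W -> False) (independent W).
Proof.
apply: (iffP forall_inP) => [H e eE eW|H e eE].
  by have := H e eE; rewrite eW.
by apply/negP => /(H e eE).
Qed.

Lemma independentS W S : S \subset W -> independent W -> independent S.
Proof.
move=> SW /independentP H; apply/independentP => e eE eS.
by apply: (H e eE); apply: subset_trans SW.
Qed.

Lemma card_supersets X T : T \subset X ->
  2 ^ #|X| <= 2 ^ #|T| * #|[set S in powerset X | T \subset S]|.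
Proof.
move=> TX.
have -> : #|X| = #|T| + #|X :\: T|.
  by rewrite cardsD (setIidPr TX) subnKC // subset_leq_card.
rewrite expnD leq_mul2l; apply/orP; right; rewrite -card_powerset.
rewrite -[leqLHS](card_in_imset (f := fun S => S :|: T)).
  apply: subset_leq_card; apply/subsetP => Z /imsetP[S]; rewrite !inE => SX ->.
  rewrite subsetUr andbT subUset TX andbT.
  by apply: subset_trans SX _; apply: subsetDl.
move=> S1 S2; rewrite !inE !subsetD => /andP[_ d1] /andP[_ d2] eq12.
have dT S : [disjoint S & T] -> (S :|: T) :\: T = S.
  by move=> d; rewrite setDUl setDv setU0; apply/setDidPl.
by rewrite -(dT _ d1) -(dT _ d2) eq12.
Qed.

(* The members of the fibre are [W0 :|: S] with [S] a subset of the set [X] of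
   available link vertices, with or without [v].  Every [S] is admissible
   without [v]; with [v] it suffices to avoid one vertex of each of the [y]
   links inside [X]. *)
Lemma fibre_bounds U v W0 :
    (forall e, e \in E -> v \in e -> #|e| = 4) ->
    v \in U -> locally_sparse U v ->
    let N := v |: link_support U v in
    let fib := [set W in indep_subsets U | W :\: N == W0] in
    fib != set0 ->
  exists x y : nat, [/\ #|fib| <= 2 ^ x.+1,
    2 ^ x <= 2 ^ y * #|[set W in fib | v \in W]| &
    y * 2 ^ x <= 8 * \sum_(W in fib) kills W v].
Proof.
move=> h4 vU /forall_inP sparse N fib /set0Pn[W1].
rewrite !inE -andbA => /and3P[W1U iW1 /eqP W1E].
have W0W1 : W0 \subset W1 by rewrite -W1E subsetDl.
have iW0 := independentS W0W1 iW1.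
have W0U : W0 \subset U by apply: subset_trans W1U.
have dW0 : [disjoint W0 & N] by rewrite -W1E -setI_eq0 setIDAC setDIl setDv setI0.
set B := link_support U v in N fib dW0 W1E *.
have vB : v \notin B.
  by apply/negP => /bigcupP[e _]; rewrite !inE eqxx.
have BU : B \subset U.
  apply/subsetP => u /bigcupP[e /andP[_ /andP[_ /subsetP eU]]].
  by rewrite !inE => /andP[_ /eU].
pose X := [set u in B | independent (u |: W0)].
pose Y := [set e in E | (v \in e) && (e :\ v \subset X)].
have XB : X \subset B by apply/subsetP => u; rewrite inE => /andP[].
have vX : v \notin X by apply: contra vB => /(subsetP XB).
have XN : X \subset N by apply: subset_trans XB (subsetUr _ _).
have vW0 : v \notin W0.
  by apply: contraTN (setU11 v B : v \in N) => /(disjointFr dW0) ->.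
(* By sparsity an edge avoiding [v] has at most one vertex in [S], so it would lie in [W0] or in
   [W0] plus one available vertex. *)
have indS S e : S \subset X -> e \in E -> v \notin e -> e \subset W0 :|: S -> False.
  move=> SX eE ve eWS.
  have eU : e \subset U.
    apply: subset_trans eWS _; rewrite subUset W0U.
    by apply: subset_trans SX (subset_trans XB BU).
  have := sparse e eE; rewrite eU ve /= -/B => c1.
  have eS : e :&: S \subset e :&: B by apply: setIS; apply: subset_trans XB.
  have {eS}c1 := leq_trans (subset_leq_card eS) c1.
  have [z0|[u uS]] := set_0Vmem (e :&: S).
    apply: (independentP _ iW0 e eE); apply/subsetP => w we.
    have /setUP[//|wS] := subsetP eWS w we.
    by have : w \in e :&: S; [rewrite inE we | rewrite z0 inE].
  have uX : u \in X by apply: (subsetP SX); move: uS; rewrite inE => /andP[].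
  move: uX; rewrite inE => /andP[_ /independentP iu]; apply: (iu e eE).
  apply/subsetP => w we; rewrite !inE.
  have /setUP[->|wS] := subsetP eWS w we; first by rewrite orbT.
  apply/orP; left; apply/eqP; apply: contraTeq c1 => wu; rewrite -ltnNge.
  by apply/card_gt1P; exists w, u; split=> //; rewrite inE we.
have SN S : S \subset X -> (W0 :|: S) :\: N = W0.
  move=> SX; rewrite setDUl (setDidPl dW0); apply/setUidPl.
  have /eqP-> : S :\: N == set0 by rewrite setD_eq0 (subset_trans SX).
  exact: sub0set.
have SvN S : S \subset X -> (v |: (W0 :|: S)) :\: N = W0.
  move=> SX; rewrite setDUl SN //.
  have /eqP-> : [set v] :\: N == set0 by rewrite setD_eq0 sub1set setU11.
  by rewrite set0U.
have SU S : S \subset X -> W0 :|: S \subset U.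
  by move=> SX; rewrite subUset W0U (subset_trans SX) // (subset_trans XB).
have indW S : S \subset X -> W0 :|: S \in fib.
  move=> SX; rewrite !inE SU // SN // eqxx andbT /=.
  apply/independentP => e eE eWS; apply: (indS S e) => //.
  apply: contraNN vX => /(subsetP eWS) /setUP[vW|/(subsetP SX)//].
  by rewrite vW in vW0.
have injW S1 S2 : S1 \subset v |: X -> S2 \subset v |: X ->
    W0 :|: S1 = W0 :|: S2 -> S1 = S2.
  have dS S : S \subset v |: X -> (W0 :|: S) :&: N = S.
    move=> SX; rewrite setIUl (eqP (_ : W0 :&: N == set0)) ?setI_eq0 // set0U.
    apply/setIidPl; apply: subset_trans SX _; rewrite subUset XN andbT.
    by rewrite sub1set setU11.
  by move=> s1 s2 eq12; rewrite -(dS _ s1) -(dS _ s2) eq12.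
exists #|X|, #|Y|; split.
(* A member of the fibre is determined by its trace on [N], which lies in [v |: X]. *)
- have -> : #|X|.+1 = #|v |: X| by rewrite cardsU1 vX.
  rewrite -card_powerset; apply: leq_trans (leq_imset_card (setU W0) _).
  apply: subset_leq_card; apply/subsetP => W.
  rewrite !inE -andbA => /and3P[WU iW /eqP WE]; apply/imsetP; exists (W :&: N); last first.
    by rewrite -WE setUC setID.
  rewrite inE; apply/subsetP => u /setIP[uW /setU1P[->|uB]]; first exact: setU11.
  apply/setU1P; right; rewrite inE uB; apply: independentS iW.
  by rewrite subUset sub1set uW -WE subsetDl.
(* [rep] picks a vertex of each link; the default [v] does not occur, as links have three vertices.
   A subset of [X] avoiding the picked vertices contains no link, so [v] can be added. *)
- pose rep e := odflt v [pick u in e :\ v].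
  pose T := X :&: (rep @: Y).
  have lT : #|X| <= #|Y| + #|X :\: T|.
    have := cardsID T X; rewrite addnC => <-; rewrite addnC leq_add2r.
    apply: leq_trans (subset_leq_card (subsetIr _ _)) _.
    apply: leq_trans (subset_leq_card (subsetIr _ _)) _.
    exact: leq_imset_card.
  apply: (@leq_trans (2 ^ (#|Y| + #|X :\: T|))); first by rewrite leq_exp2l.
  rewrite expnD leq_mul2l; apply/orP; right; rewrite -card_powerset.
  rewrite -[leqLHS](card_in_imset (f := fun S => W0 :|: (v |: S))); last first.
    move=> S1 S2; rewrite !inE !subsetD => /andP[s1 _] /andP[s2 _] eq12.
    have := injW _ _ (setUS [set v] s1) (setUS [set v] s2) eq12.
    move=> /(congr1 (fun S => S :\ v)); rewrite !setU1K //.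
      by apply: contra vX => /(subsetP s2).
    by apply: contra vX => /(subsetP s1).
  apply: subset_leq_card; apply/subsetP => Z /imsetP[S].
  rewrite powersetE subsetD => /andP[SX dST] ->.
  rewrite setUCA; apply/setIdP; split; last exact: setU11.
  rewrite !inE SvN // eqxx andbT.
  rewrite subUset sub1set vU SU //=.
  apply/independentP => e eE eW.
  have [ve|ve] := boolP (v \in e); last first.
    apply: (indS S e) => //; apply/subsetP => u ue.
    have /setU1P[uv|//] := subsetP eW u ue.
    by rewrite uv (negPf ve) in ue.
  have eU : e \subset U.
    by apply: subset_trans eW _; rewrite subUset sub1set vU SU.
  have eB : e :\ v \subset B by apply: (bigcup_sup e); rewrite // eE ve.
  have eS : e :\ v \subset S.
    apply/subsetP => u ue; have := subsetP eB u ue => uB.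
    move: ue; rewrite !inE => /andP[uv /(subsetP eW)].
    rewrite !inE (negPf uv) /= => /orP[uW|//].
    by have := disjointFr dW0 uW; rewrite !inE uB orbT.
  have eY : e \in Y by rewrite inE eE ve (subset_trans eS).
  have re : rep e \in e :\ v.
    rewrite /rep; case: pickP => [//|e0].
    have := h4 e eE ve; rewrite (cardsD1 v) ve.
    by rewrite (eq_card0 (A := mem (e :\ v))) // => u; rewrite e0.
  have rS := subsetP eS _ re.
  have : rep e \in T by rewrite inE (subsetP SX) // imset_f.
  by rewrite (disjointFr dST).
(* Each link in [Y] has three vertices and so lies in at least one eighth of the subsets of [X]. *)
- apply: (@leq_trans (8 * \sum_(S in powerset X) #|[set e in Y | e :\ v \subset S]|)).
    have -> : \sum_(S in powerset X) #|[set e in Y | e :\ v \subset S]| =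
        \sum_(e in Y) #|[set S in powerset X | e :\ v \subset S]|.
      under eq_bigr => S _ do rewrite -sum1dep_card big_mkcondr.
      rewrite exchange_big; apply: eq_bigr => e _.
      by rewrite -sum1dep_card big_mkcondr.
    rewrite big_distrr -sum_nat_const /=; apply: leq_sum => e.
    rewrite inE => /and3P[eE ve eX].
    have c3 : #|e :\ v| = 3 by have := h4 e eE ve; rewrite (cardsD1 v) ve => -[].
    by have := card_supersets eX; rewrite c3.
  rewrite leq_mul2l /=.
  apply: (@leq_trans (\sum_(S in powerset X) kills (W0 :|: S) v)).
    apply: leq_sum => S _; apply: subset_leq_card; apply/subsetP => e.
    rewrite !inE => /andP[/and3P[-> -> _] eS] /=.
    by apply: subset_trans eS (subsetUr _ _).
  rewrite -(big_imset (h := fun S => W0 :|: S) (fun W => kills W v)) /=; last first.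
    move=> S1 S2; rewrite !inE => s1 s2.
    by apply: injW; apply: (subset_trans _ (subsetUr _ _)).
  rewrite [leqRHS](big_setID ((setU W0) @: powerset X)) /=.
  rewrite (setIidPr _) ?leq_addr //.
  by apply/subsetP => Z /imsetP[S]; rewrite inE => SX ->; apply: indW.
Qed.

Local Open Scope ring_scope.

(** Split by [W :\: N]: a fibre has at most [2 ^ x.+1] members and contributes at least
    [2 ^ x * (M * 2 ^- y + y / 8)]. The hypothesis on [L] compares the two; it allows [L] of order
    ln M, since one term is large for small [y] and the other for large [y]. *)
Lemma local_bound (R : realFieldType) (M L : R) U v :
    0 <= M -> 0 <= L ->
    (forall y : nat, 2 * L <= M * 2 ^- y + y%:R / 8) ->
    (forall e, e \in E -> v \in e -> #|e| = 4) ->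
    v \in U -> locally_sparse U v ->
  L * #|indep_subsets U|%:R
    <= \sum_(W in indep_subsets U) (M * (v \in W)%:R + (kills W v)%:R).
Proof.
move=> M0 L0 ML h4 vU sp.
rewrite -sumr_const mulr_sumr.
pose N := v |: link_support U v.
rewrite (partition_big (fun W => W :\: N) predT) //=.
rewrite [leRHS](partition_big (fun W => W :\: N) predT) //=.
apply: ler_sum => W0 _.
pose fib := [set W in indep_subsets U | W :\: N == W0].
have fE W : (W \in indep_subsets U) && (W :\: N == W0) = (W \in fib) by rewrite [RHS]inE.
rewrite !(eq_bigl _ _ fE).
have [->|f0] := eqVneq fib set0; first by rewrite !big_set0.
have [x [y [b1 b2 b3]]] := fibre_bounds h4 vU sp f0.
rewrite -/N -/fib in b1 b2 b3.
rewrite -mulr_sumr sumr_const big_split /= -mulr_sumr.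
have -> : \sum_(W in fib) (v \in W)%:R = #|[set W in fib | v \in W]|%:R :> R.
  rewrite -sum1dep_card natr_sum [RHS]big_mkcondr; apply: eq_bigr => W _ /=.
  by case: (v \in W).
rewrite -natr_sum.
move: b1 b2 b3; rewrite -!(ler_nat R) !natrM !natrX exprS => b1 b2 b3.
set a := #|[set W in fib | v \in W]|%:R in b2 *.
set s := (\sum_(W in fib) _)%:R in b3 *.
have y0 : 0 < 2 ^+ y :> R by rewrite exprn_gt0.
have x0 : 0 < 2 ^+ x :> R by rewrite exprn_gt0.
apply: (@le_trans _ _ (2 ^+ x * (2 * L))).
  by rewrite mulrCA mulrA [L * _]mulrC ler_wpM2r // mulrC.
apply: (@le_trans _ _ (2 ^+ x * (M * 2 ^- y + y%:R / 8))).
  by rewrite ler_pM2l.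
rewrite mulrDr; apply: lerD.
  rewrite mulrCA ler_wpM2l // ler_pdivrMr //; lra.
lra.
Qed.

End IndependentSets.

(** * Averaging over a random vertex set *)

Section RandomSubset.
Variables (V : finType) (R : realFieldType) (q : R).
Implicit Types (U S : {set V}) (v : V).
Local Open Scope ring_scope.

(** The probability of [U] when each vertex is kept independently with probability [q]; sums
    weighted by it are expectations. *)
Definition wt U : R := \prod_v (if v \in U then q else 1 - q).

Lemma wt_ge0 U : 0 <= q <= 1 -> 0 <= wt U.
Proof.
by move=> /andP[q0 q1]; apply: prodr_ge0 => v _; case: ifP; rewrite ?subr_ge0.
Qed.

Lemma sum_wt S : \sum_(U : {set V} | S \subset U) wt U = q ^+ #|S|.
Proof.
transitivity (\prod_v (q + (if v \in S then 0 else 1 - q))).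
  rewrite bigA_distr [LHS]big_mkcond; apply: eq_bigr => U _.
  case: ifPn => [/subsetP SU|/subsetPn[u uS uU]].
    apply: eq_bigr => v _; case: ifPn => // vU.
    by rewrite ifN //; apply: contra vU; apply: SU.
  by rewrite (bigD1 u) //= (negPf uU) uS mul0r.
rewrite -prodr_const [RHS]big_mkcond; apply: eq_bigr => v _.
by case: (v \in S); [rewrite addr0|rewrite addrC subrK].
Qed.

Lemma sum_wt_all : \sum_(U : {set V}) wt U = 1.
Proof.
rewrite -(expr0 q) -(cards0 V) -sum_wt; apply: eq_bigl => U.
by rewrite sub0set.
Qed.

Lemma wtU1 U v : v \notin U -> (1 - q) * wt (v |: U) = q * wt U.
Proof.
move=> vU; rewrite /wt (bigD1 v) //= setU11 [in RHS](bigD1 v) //= (negPf vU).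
rewrite mulrCA; congr (_ * (_ * _)); apply: eq_bigr => u /negPf uv.
by rewrite !inE uv.
Qed.

Lemma sum_wt_card : \sum_(U : {set V}) wt U * #|U|%:R = q * #|V|%:R.
Proof.
under eq_bigr => U _.
  rewrite -sumr_const mulr_sumr big_mkcond.
  over.
rewrite exchange_big /= mulr_natr.
transitivity (\sum_(v : V) q); last by rewrite sumr_const.
apply: eq_bigr => v _; rewrite -big_mkcond /= -[RHS]expr1 -(cards1 v) -sum_wt.
by apply: eq_big => U; rewrite ?sub1set ?mulr1.
Qed.

End RandomSubset.

Section Averaging.
Variables (V : finType) (E : {set {set V}}) (d : nat).
Hypothesis card_edge : forall e, e \in E -> #|e| = 4.
Hypothesis codegree :
  forall T : {set V}, #|T| = 3 -> #|[set e in E | T \subset e]| <= d.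
Implicit Types (R : realFieldType) (U W S T A e : {set V}) (v : V).

(** Count pairs of an edge [e] and a vertex [v] of it by the triple [e :\ v]: each triple of [W]
    lies in at most [d] edges. *)
Lemma sum_kills_le W : \sum_v kills E W v <= d * 'C(#|W|, 3).
Proof.
have -> : \sum_v kills E W v = \sum_(e in E) #|[set v in e | e :\ v \subset W]|.
  rewrite /kills; under eq_bigr => v _ do rewrite -sum1dep_card big_mkcondr.
  rewrite exchange_big; apply: eq_bigr => e _.
  by rewrite -big_mkcond sum1dep_card.
apply: (@leq_trans (\sum_(e in E)
    #|[set T : {set V} in [set T : {set V} | T \subset W & #|T| == 3] | T \subset e]|)).
  apply: leq_sum => e eE.
  rewrite -[leqLHS](card_in_imset (f := fun v => e :\ v)); last first.
    move=> u v; rewrite !inE => /andP[ue _] /andP[ve _] /setP/(_ u).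
    by rewrite !inE eqxx ue /= andbT; case: eqVneq.
  apply: subset_leq_card; apply/subsetP => T /imsetP[v]; rewrite !inE.
  move=> /andP[ve eW] ->; rewrite eW subsetDl andbT /=.
  by have := card_edge eE; rewrite (cardsD1 v) ve => -[/eqP].
under eq_bigr => e _ do rewrite -sum1dep_card big_mkcondr.
rewrite exchange_big /= -cards_draws mulnC -sum_nat_const; apply: leq_sum => T.
rewrite inE => /andP[_ /eqP T3]; apply: leq_trans (codegree T3).
by rewrite -sum1dep_card big_mkcondr.
Qed.

(** Induction on [3 - #|S|]: an edge containing [S] contains some [u |: S] with [u] outside [S]. *)
Lemma degree_le S : #|S| <= 3 ->
  #|[set e in E | S \subset e]| <= d * #|V| ^ (3 - #|S|).
Proof.
move=> S3; move Ej : (3 - #|S|) => j.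
elim: j S S3 Ej => [|j IH] S S3 Ej.
  by rewrite muln1 codegree //; lia.
apply: (@leq_trans (\sum_(u in ~: S) #|[set e in E | u |: S \subset e]|)).
  under eq_bigr => u _ do rewrite -sum1dep_card big_mkcondr.
  rewrite exchange_big -sum1dep_card big_mkcondr /=; apply: leq_sum => e eE.
  case: ifP => // Se.
  have /set0Pn[u] : e :\: S != set0.
    by rewrite -card_gt0 cardsD (setIidPr Se) (card_edge eE); lia.
  rewrite inE => /andP[uS ue]; rewrite (bigD1 u) ?inE //= subUset sub1set ue Se.
  by [].
apply: (@leq_trans (#|~: S| * (d * #|V| ^ j))).
  rewrite -sum_nat_const; apply: leq_sum => u; rewrite inE => uS.
  by apply: IH; rewrite cardsU1 uS; lia.
by rewrite expnS mulnCA leq_mul2l leq_mul2r max_card !orbT.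
Qed.

Lemma card_meeting_le A j : j <= 3 ->
  #|[set e in E | #|e :&: A| == j]| <= 2 ^ #|A| * (d * #|V| ^ (3 - j)).
Proof.
move=> j3.
rewrite -card_powerset -sum_nat_const.
apply: (@leq_trans (\sum_(S in powerset A | #|S| == j) #|[set e in E | S \subset e]|)).
  under eq_bigr => S _ do rewrite -sum1dep_card big_mkcondr.
  rewrite exchange_big -sum1dep_card big_mkcondr /=; apply: leq_sum => e eE.
  case: ifP => // eA.
  by rewrite (bigD1 (e :&: A)) ?powersetE ?subsetIr ?eA //= subsetIl.
rewrite big_mkcondr; apply: leq_sum => S _; case: ifP => // /eqP Sj.
by rewrite -Sj degree_le // Sj.
Qed.

Local Open Scope ring_scope.

Lemma indep_subsets_gt0 R U : 0 < #|indep_subsets E U|%:R :> R.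
Proof.
rewrite ltr0n card_gt0; apply/set0Pn; exists set0; rewrite inE sub0set.
apply/independentP => e eE; rewrite subset0 => /eqP e0.
by have := card_edge eE; rewrite e0 cards0.
Qed.

Definition avg R U (F : {set V} -> R) : R :=
  (\sum_(W in indep_subsets E U) F W) / #|indep_subsets E U|%:R.

Lemma avg_le R U (F : {set V} -> R) c :
  (forall W, W \in indep_subsets E U -> F W <= c) ->
  avg U F <= c.
Proof.
move=> Fc; rewrite ler_pdivrMr ?indep_subsets_gt0 // mulr_natr -sumr_const.
exact: ler_sum.
Qed.

(* Comparing subsets with and without [v] keeps the factor [q] that the codegree
   bound inside the random set would lose. *)
Lemma avg_kills_exchange R U v : v \notin U ->
  avg (v |: U) (fun W => (kills E W v)%:R) <= avg U (fun W => (kills E W v)%:R) :> R.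
Proof.
move=> vU.
have IS : indep_subsets E U \subset indep_subsets E (v |: U).
  apply/subsetP => W; rewrite !inE => /andP[WU ->]; rewrite andbT.
  by apply: subset_trans WU (subsetUr _ _).
rewrite /avg.
(* A new independent set contains [v], so it contains no link of [v] and adds nothing to the sum;
   only the number of sets grows. *)
have -> : \sum_(W in indep_subsets E (v |: U)) (kills E W v)%:R
        = \sum_(W in indep_subsets E U) (kills E W v)%:R :> R.
  rewrite (big_setID (indep_subsets E U)) /= (setIidPr IS) [X in _ + X]big1 ?addr0 // => W.
  rewrite !inE => /andP[+ /andP[WvU iW]]; rewrite iW andbT => WU.
  apply/eqP; rewrite pnatr_eq0 cards_eq0.
  apply: contraT => /set0Pn[e]; rewrite inE => /and3P[eE ve eW].
  exfalso; apply: (independentP _ _ iW e eE); apply/subsetP => u ue.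
  have [->|uv] := eqVneq u v; last by apply: (subsetP eW); rewrite !inE uv.
  apply: contraR WU => vW; apply/subsetP => w wW.
  have /setU1P[wv|//] := subsetP WvU w wW.
  by rewrite -wv wW in vW.
apply: ler_wpM2l; first by apply: sumr_ge0.
rewrite lef_pV2 ?posrE ?indep_subsets_gt0 //.
by rewrite ler_nat subset_leq_card.
Qed.

(** Removing [v] does not lower the average of its kills, and the weight with [v] is at most [2 * q]
    times the weight without it, because [q <= 1 / 2]. For each [W] the kills over all [v] are then
    counted by triples. *)
Lemma sum_avg_kills_le R (q : R) s : 0 < q -> q <= 1 / 2 ->
    (forall W, independent E W -> (#|W| <= s)%N) ->
  \sum_(U : {set V}) wt q U * \sum_(v in U) avg U (fun W => (kills E W v)%:R)
    <= 2 * q * (d * 'C(s, 3))%:R.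
Proof.
move=> q_gt0 q_le_half hs.
have wt0 U : 0 <= wt q U by apply: wt_ge0; apply/andP; split; lra.
under eq_bigr => U _ do rewrite mulr_sumr big_mkcond.
rewrite exchange_big /=.
apply: (@le_trans _ _ (\sum_v \sum_(U : {set V})
    2 * q * (wt q U * avg U (fun W => (kills E W v)%:R)))).
  apply: ler_sum => v _; rewrite -big_mkcond /=.
  rewrite [leLHS](reindex_onto (fun U => v |: U) (fun U => U :\ v)) /=; last first.
    by move=> U vU; rewrite setD1K.
  rewrite big_mkcond; apply: ler_sum => U _.
  have a0 : 0 <= avg U (fun W => (kills E W v)%:R) :> R.
    by rewrite /avg divr_ge0 ?ler0n ?sumr_ge0.
  rewrite setU11 /=; case: ifP => [/eqP vU|_]; last first.
    by apply: mulr_ge0; [rewrite mulr_ge0 // ltW|apply: (mulr_ge0 (wt0 U) a0)].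
  have {}vU : v \notin U by rewrite -vU !inE eqxx.
  apply: le_trans (ler_wpM2l (wt0 _) (avg_kills_exchange R vU)) _.
  rewrite mulrA; apply: ler_wpM2r => //.
  have aux (a b : R) : (1 - q) * b = q * a -> 0 <= b -> b <= 2 * q * a by nra.
  exact: aux (wtU1 q vU) (wt0 _).
rewrite exchange_big /=.
under eq_bigr => U _ do rewrite -!mulr_sumr.
rewrite -mulr_sumr; apply: ler_wpM2l; first by rewrite mulr_ge0 // ltW.
apply: (@le_trans _ _ (\sum_(U : {set V}) wt q U * (d * 'C(s, 3))%:R)).
  apply: ler_sum => U _; apply: ler_wpM2l => //.
  rewrite -mulr_suml exchange_big /=; apply: avg_le => W.
  rewrite inE => /andP[_ iW]; rewrite -natr_sum ler_nat.
  apply: leq_trans (sum_kills_le W) _; rewrite leq_mul2l; apply/orP; right.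
  exact: leq_bin2l (hs W iW).
by rewrite -mulr_suml sum_wt_all mul1r.
Qed.

End Averaging.

(** * Sparseness of a random vertex set *)

Section Sparseness.
Variables (V : finType) (E : {set {set V}}) (d : nat).
Hypothesis card_edge : forall e, e \in E -> #|e| = 4.
Hypothesis codegree :
  forall T : {set V}, #|T| = 3 -> #|[set e in E | T \subset e]| <= d.
Implicit Types (R : realFieldType) (U W S T A e : {set V}) (v : V).

(** Some edge [e] avoiding [v] has two vertices in links of [v]. Either one edge at [v] meets [e] at
    least twice, in fewer than four vertices since it contains [v], or two edges at [v] meet [e]
    once each. *)
Lemma not_locally_sparse U v : ~~ locally_sparse E U v ->
  (exists e1 e, [/\ (e1 \in E) && (v \in e1), e \in E,
     (#|e :&: e1| == 2) || (#|e :&: e1| == 3) & e1 :|: e \subset U]) \/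
  (exists e1 e2 e, [/\ (e1 \in E) && (v \in e1),
     [&& e2 \in E, v \in e2 & e2 != e1],
     e \in E, #|e :&: (e1 :|: e2)| == 2 & e1 :|: e2 :|: e \subset U]).
Proof.
move=> /forall_inPn[e eE]; rewrite negb_imply -ltnNge => /andP[/andP[eU ve]].
move=> /card_gt1P[x [y [/setIP[xe xN] /setIP[ye yN] xy]]].
have caseA f : f \in E -> v \in f -> f \subset U -> 1 < #|e :&: f| ->
    (#|e :&: f| == 2) || (#|e :&: f| == 3).
  move=> fE vf fU c2.
  have : #|e :&: f| < 4.
    rewrite -(card_edge fE); apply: proper_card; rewrite properE subsetIr.
    by apply/subsetPn; exists v; rewrite // inE negb_and ve.
  by move: c2; case: #|_| => [|[|[|[|]]]].
case/bigcupP: xN => e1 /andP[e1E /andP[ve1 e1U]]; rewrite inE => /andP[_ xe1].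
case/bigcupP: yN => e2 /andP[e2E /andP[ve2 e2U]]; rewrite inE => /andP[_ ye2].
have [c1|c1] := ltnP 1 #|e :&: e1|.
  by left; exists e1, e; rewrite e1E ve1 caseA // subUset e1U.
have [c2|c2] := ltnP 1 #|e :&: e2|.
  by left; exists e2, e; rewrite e2E ve2 caseA // subUset e2U.
right; exists e1, e2, e; rewrite e1E ve1 e2E ve2 !subUset e1U e2U eE.
split=> //.
  apply: contraTneq c1 => e12; rewrite -ltnNge; apply/card_gt1P; exists x, y.
  by rewrite !inE xe xe1 ye -e12 ye2.
rewrite eqn_leq; apply/andP; split; last first.
  by apply/card_gt1P; exists x, y; rewrite !inE xe xe1 ye ye2 orbT.
rewrite setIUr; apply: leq_trans (leq_card_setU _ _) _.
exact: leq_add c1 c2.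
Qed.

Local Open Scope ring_scope.

Lemma ex_sum R (q : R) (J : finType) (P : pred J) (F : J -> {set V} -> R) :
  \sum_(U : {set V}) wt q U * (\sum_(j | P j) F j U)
    = \sum_(j | P j) \sum_(U : {set V}) wt q U * F j U.
Proof. by rewrite exchange_big; apply: eq_bigr => U _; rewrite mulr_sumr. Qed.

Lemma ex_subset R (q : R) S :
  \sum_(U : {set V}) wt q U * (S \subset U)%:R = q ^+ #|S|.
Proof.
rewrite -sum_wt [RHS]big_mkcond; apply: eq_bigr => U _.
by case: ifP; rewrite ?mulr1 ?mulr0.
Qed.

(** [q ^+ #|A :|: e|] is the probability that [A] and [e] both survive; the union has
    [#|A| + (4 - j)] vertices. *)
Lemma sum_meeting_le R (q : R) A j : 0 <= q -> (j <= 3)%N ->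
  \sum_(e in E | #|e :&: A| == j) q ^+ #|A :|: e|
    <= q ^+ #|A| * q ^+ (4 - j) * (2 ^+ #|A| * (d%:R * #|V|%:R ^+ (3 - j))).
Proof.
move=> q0 j3.
rewrite (eq_bigr (fun=> q ^+ #|A| * q ^+ (4 - j))); last first.
  move=> e /andP[eE /eqP ej]; rewrite -exprD cardsU setIC ej (card_edge eE).
  by rewrite addnBA //; lia.
rewrite sumr_const -[leLHS]mulr_natr; apply: ler_wpM2l; first by rewrite mulr_ge0 ?exprn_ge0.
rewrite -!natrX -!natrM ler_nat.
have := card_meeting_le card_edge codegree A j3.
by apply: leq_trans; rewrite leq_eqVlt; apply/orP; left; apply/eqP; apply: eq_card => e; rewrite !inE.
Qed.

(* If an unsparse vertex [v] is not explained by an edge meeting a link of [v]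
   twice, then some edge joins two different links of [v]. *)
Lemma sum_unsparse_le R (q : R) :
    0 < q -> q <= 1 / 2 -> 1 <= #|V|%:R ^+ 2 * q ^+ 3 ->
  \sum_(U : {set V}) wt q U * #|[set v in U | ~~ locally_sparse E U v]|%:R
    <= 10 ^+ 5 * d%:R ^+ 3 * #|V|%:R ^+ 6 * q ^+ 9.
Proof.
move=> q0 q2 nq; set n : R := #|V|%:R in nq *; set D : R := d%:R.
have n0 : 0 <= n by rewrite ler0n.
have D0 : 0 <= D by rewrite ler0n.
have q0' : 0 <= q by apply: ltW.
have D23 : D ^+ 2 <= D ^+ 3.
  rewrite /D; case: d => [|d']; first by rewrite !expr0n.
  by apply: ler_weXn2l; rewrite // ler1n.
(* Counts the configurations of [not_locally_sparse] inside [U] whose first edge at [v] is [e1]. *)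
pose T v (e1 : {set V}) U : R :=
  (\sum_(e in E | #|e :&: e1| == 2%N) (e1 :|: e \subset U)%:R
    + \sum_(e in E | #|e :&: e1| == 3%N) (e1 :|: e \subset U)%:R)
  + \sum_(e2 in E | (v \in e2) && (e2 != e1))
      \sum_(e in E | #|e :&: (e1 :|: e2)| == 2%N) (e1 :|: e2 :|: e \subset U)%:R.
have T0 v e1 U : 0 <= T v e1 U.
  by rewrite !addr_ge0 // sumr_ge0 // => e2 _; rewrite sumr_ge0.
have unsparseT U v :
    (~~ locally_sparse E U v)%:R <= \sum_(e1 in E | v \in e1) T v e1 U.
  have [_|/not_locally_sparse] := boolP (locally_sparse E U v).
    by apply: sumr_ge0.
  case=> [[e1 [e [/andP[e1E ve1] eE]]] + sub|[e1 [e2 [e]]]].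
    rewrite (bigD1 e1) ?e1E //= => c; apply: ler_wpDr; first exact: sumr_ge0.
    apply: ler_wpDr; first by apply: sumr_ge0 => e2 _; apply: sumr_ge0.
    case/orP: c => c; [apply: ler_wpDr|apply: ler_wpDl]; try exact: sumr_ge0.
      by rewrite (bigD1 e) ?eE //= sub lerDl sumr_ge0.
    by rewrite (bigD1 e) ?eE //= sub lerDl sumr_ge0.
  move=> [/andP[e1E ve1] /and3P[e2E ve2 e21] eE c sub].
  rewrite (bigD1 e1) ?e1E //=; apply: ler_wpDr; first exact: sumr_ge0.
  apply: ler_wpDl; first by rewrite addr_ge0 // sumr_ge0.
  rewrite (bigD1 e2) ?e2E ?ve2 //=; apply: ler_wpDr.
    by apply: sumr_ge0 => f _; apply: sumr_ge0.
  by rewrite (bigD1 e) ?eE //= sub lerDl sumr_ge0.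
(* Bounds the expectation of [T], uniformly in [v] and [e1]. The factor 16 is [2 ^ 4], for the
   traces on [e1]; 128 is [2 ^ 7], as [e1 :|: e2] has at most seven vertices. *)
pose K : R := q ^+ 4 * (16 * D) * (q ^+ 2 * n + q)
  + 128 * D * n * q ^+ 2 * (16 * D * q ^+ 4 * (q ^+ 3 * n ^+ 2 + q ^+ 2 * n + q)).
have TK v e1 : e1 \in E -> v \in e1 -> \sum_(U : {set V}) wt q U * T v e1 U <= K.
  move=> e1E ve1; rewrite /T.
  under eq_bigr => U _ do rewrite !mulrDr.
  rewrite !big_split /= !ex_sum; apply: lerD.
    have m2 := sum_meeting_le e1 q0' (isT : (2 <= 3)%N).
    have m3 := sum_meeting_le e1 q0' (isT : (3 <= 3)%N).
    under eq_bigr => e _ do rewrite ex_subset.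
    under [X in _ + X <= _]eq_bigr => e _ do rewrite ex_subset.
    apply: le_trans (lerD m2 m3) _; rewrite (card_edge e1E) -/n -/D.
    by rewrite le_eqVlt; apply/orP; left; apply/eqP; ring.
  apply: (@le_trans _ _ (\sum_(e2 in E | (v \in e2) && (e2 != e1))
      q ^+ #|e1 :|: e2| * (128 * D * n * q ^+ 2))).
    apply: ler_sum => e2 /andP[e2E /andP[ve2 _]].
    rewrite ex_sum; under eq_bigr => e _ do rewrite ex_subset.
    apply: le_trans (sum_meeting_le (e1 :|: e2) q0' (isT : (2 <= 3)%N)) _.
    rewrite -mulrA; apply: ler_wpM2l; first exact: exprn_ge0.
    rewrite -/n -/D expr1.
    have c7 : (#|e1 :|: e2| <= 7)%N.
      rewrite cardsU (card_edge e1E) (card_edge e2E).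
      have : (0 < #|e1 :&: e2|)%N by apply/card_gt0P; exists v; rewrite inE ve1.
      by lia.
    have -> : 128 * D * n * q ^+ 2 = q ^+ 2 * (2 ^+ 7 * (D * n)) by ring.
    apply: ler_wpM2l; first exact: exprn_ge0.
    apply: ler_wpM2r; first exact: mulr_ge0.
    by rewrite -!natrX ler_nat leq_exp2l.
  rewrite -mulr_suml mulrC; apply: ler_wpM2l.
    by rewrite !mulr_ge0 // exprn_ge0.
  pose G j := \sum_(e2 in E | #|e2 :&: e1| == j) q ^+ #|e1 :|: e2|.
  apply: (@le_trans _ _ (G 1%N + G 2%N + G 3%N)).
    rewrite /G !big_mkcondr -!big_split /=; apply: ler_sum => e2 e2E.
    have qq : 0 <= q ^+ #|e1 :|: e2| by apply: exprn_ge0.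
    case: ifP => [/andP[ve2 e21]|_]; last by rewrite !addr_ge0 //; case: ifP.
    have c0 : (0 < #|e2 :&: e1|)%N by apply/card_gt0P; exists v; rewrite inE ve2.
    have c4 : (#|e2 :&: e1| < 4)%N.
      rewrite ltnNge; apply: contra e21 => c4.
      have /eqP s2 : e2 :&: e1 == e2 by rewrite eqEcard subsetIl (card_edge e2E).
      have /eqP s1 : e2 :&: e1 == e1 by rewrite eqEcard subsetIr (card_edge e1E).
      by rewrite -s1 -{1}s2.
    move: c0 c4; case: #|e2 :&: e1| => [|[|[|[|]]]] //= _ _;
      by rewrite ?addr0 ?add0r.
  have m1 := sum_meeting_le e1 q0' (isT : (1 <= 3)%N).
  have m2 := sum_meeting_le e1 q0' (isT : (2 <= 3)%N).
  have m3 := sum_meeting_le e1 q0' (isT : (3 <= 3)%N).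
  apply: le_trans (lerD (lerD m1 m2) m3) _; rewrite (card_edge e1E) -/n -/D.
  by rewrite le_eqVlt; apply/orP; left; apply/eqP; ring.
have cardE : #|E|%:R <= D * n ^+ 3.
  rewrite -natrX -natrM ler_nat.
  have := @degree_le _ _ _ card_edge codegree set0.
  rewrite cards0 subn0 => /(_ isT); apply: leq_trans.
  by apply: subset_leq_card; apply/subsetP => e eE; rewrite inE eE sub0set.
have nq1 : 1 <= n * q.
  rewrite -(@expr_ge1 _ 2) ?mulr_ge0 // exprMn; apply: le_trans nq _.
  by apply: ler_wpM2l; [exact: exprn_ge0|apply: ler_wiXn2l => //; lra].
have K0 : 0 <= K by rewrite !(addr_ge0, mulr_ge0) ?exprn_ge0.
(* At most [D * n ^+ 3] edges [e1], each counted for its four vertices [v]. *)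
apply: (@le_trans _ _ (4 * (D * n ^+ 3) * K)).
  apply: (@le_trans _ _
      (\sum_(U : {set V}) wt q U * \sum_v \sum_(e1 in E | v \in e1) T v e1 U)).
    apply: ler_sum => U _; apply: ler_wpM2l.
      by apply: wt_ge0; rewrite q0' /=; lra.
    rewrite -sum1dep_card natr_sum big_mkcond; apply: ler_sum => v _.
    apply: le_trans (unsparseT U v); case: (v \in U) => //=.
    by case: ifP.
  rewrite ex_sum.
  apply: (@le_trans _ _ (\sum_v \sum_(e1 in E | v \in e1) K)).
    apply: ler_sum => v _; rewrite ex_sum.
    by apply: ler_sum => e1 /andP[e1E ve1]; apply: TK.
  under eq_bigr => v _ do rewrite big_mkcondr.
  rewrite exchange_big /=.
  apply: (@le_trans _ _ (\sum_(e1 in E) 4 * K)).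
    apply: ler_sum => e1 e1E; rewrite -big_mkcond sumr_const (card_edge e1E).
    by rewrite -[leLHS]mulr_natl.
  rewrite sumr_const -[leLHS]mulr_natl [leRHS](_ : _ = D * n ^+ 3 * (4 * K)); last ring.
  by apply: ler_wpM2r; rewrite ?mulr_ge0.
(* Since [n * q >= 1] and [n ^+ 2 * q ^+ 3 >= 1], every term is dominated by [n ^+ 6 * q ^+ 9]. *)
have h1 : q <= q ^+ 2 * n by have := ler_wpM2l q0' nq1; rewrite mulr1 expr2 -mulrA [q * n]mulrC.
have h2 : q ^+ 2 * n <= q ^+ 3 * n ^+ 2.
  have := ler_wpM2l (_ : 0 <= q ^+ 2 * n) nq1; rewrite mulr1.
  by rewrite [_ * (n * q)](_ : _ = q ^+ 3 * n ^+ 2); [apply; rewrite mulr_ge0 ?exprn_ge0|ring].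
have h3 : n ^+ 4 * q ^+ 6 <= n ^+ 6 * q ^+ 9.
  have := ler_wpM2l (_ : 0 <= n ^+ 4 * q ^+ 6) nq; rewrite mulr1.
  by rewrite [_ * (n ^+ 2 * _)](_ : _ = n ^+ 6 * q ^+ 9); [apply; rewrite mulr_ge0 ?exprn_ge0|ring].
have hA : D ^+ 2 * (n ^+ 3 * q ^+ 4 * (q ^+ 2 * n + q))
    <= D ^+ 3 * (2 * (n ^+ 6 * q ^+ 9)).
  apply: ler_pM; rewrite ?mulr_ge0 ?addr_ge0 ?mulr_ge0 ?exprn_ge0 //.
  apply: (@le_trans _ _ (n ^+ 3 * q ^+ 4 * (q ^+ 2 * n + q ^+ 2 * n))).
    by apply: ler_wpM2l; rewrite ?mulr_ge0 ?exprn_ge0 // lerD2l.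
  by rewrite [leLHS](_ : _ = 2 * (n ^+ 4 * q ^+ 6)); [rewrite ler_pM2l|ring].
have hB : n ^+ 4 * q ^+ 6 * (q ^+ 3 * n ^+ 2 + q ^+ 2 * n + q)
    <= 3 * (n ^+ 6 * q ^+ 9).
  apply: (@le_trans _ _ (n ^+ 4 * q ^+ 6 * (3 * (q ^+ 3 * n ^+ 2)))).
    by apply: ler_wpM2l; [rewrite mulr_ge0 ?exprn_ge0|lra].
  by rewrite le_eqVlt; apply/orP; left; apply/eqP; ring.
rewrite [leLHS](_ : _ = 64 * (D ^+ 2 * (n ^+ 3 * q ^+ 4 * (q ^+ 2 * n + q)))
  + 2 ^+ 13 * (D ^+ 3 * (n ^+ 4 * q ^+ 6 * (q ^+ 3 * n ^+ 2 + q ^+ 2 * n + q)))); last by rewrite /K; ring.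
have hB' := ler_wpM2l (exprn_ge0 3 D0) hB.
have [X Xdef] : {X : R | X = D ^+ 3 * (n ^+ 6 * q ^+ 9)} by eexists.
have X0 : 0 <= X by rewrite Xdef !mulr_ge0 ?exprn_ge0.
rewrite [leRHS](_ : _ = 10 ^+ 5 * X); last by rewrite Xdef; ring.
rewrite [leRHS](_ : _ = 2 * X) in hA; last by rewrite Xdef; ring.
rewrite [leRHS](_ : _ = 3 * X) in hB'; last by rewrite Xdef; ring.
(* The total constant is 128 + 24576, below [10 ^+ 5]. *)
apply: (@le_trans _ _ (64 * (2 * X) + 2 ^+ 13 * (3 * X))).
  by apply: lerD; rewrite ler_pM2l ?exprn_gt0.
by rewrite mulrA [X in _ + X]mulrA -mulrDl; apply: ler_wpM2r => //; lra.
Qed.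

(** Average [local_bound] over the random [U] and over [W]. The hypothesis with [q ^+ 8] keeps the
    expected number of unsparse vertices below half of the expected size [q * #|V|]; membership in
    [W] contributes at most [M * s], and the kills are bounded by [sum_avg_kills_le]. *)
Theorem independence_number_bound R (q M L : R) (s : nat) :
    0 < q -> q <= 1 / 2 -> 1 <= #|V|%:R ^+ 2 * q ^+ 3 ->
    2 * 10 ^+ 5 * d%:R ^+ 3 * #|V|%:R ^+ 5 * q ^+ 8 <= 1 ->
    0 <= M -> 0 <= L ->
    (forall y : nat, 2 * L <= M * 2 ^- y + y%:R / 8) ->
    (forall W, independent E W -> (#|W| <= s)%N) ->
  L * (q * #|V|%:R / 2) <= M * s%:R + 2 * q * (d * 'C(s, 3))%:R.
Proof.
move=> q0 q2 nq nq' M0 L0 ML hs.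
have wt0 U : 0 <= wt q U by apply: wt_ge0; rewrite (ltW q0) /=; lra.
pose kill U v : R := avg E U (fun W => (kills E W v)%:R).
have kill0 U v : 0 <= kill U v by rewrite /kill /avg divr_ge0 // sumr_ge0.
have sparse_le U : L * (#|U|%:R - #|[set v in U | ~~ locally_sparse E U v]|%:R)
    <= M * s%:R + \sum_(v in U) kill U v.
  have -> : #|U|%:R - #|[set v in U | ~~ locally_sparse E U v]|%:R
      = #|[set v in U | locally_sparse E U v]|%:R :> R.
    rewrite -(cardsID [set v | locally_sparse E U v] U) natrD.
    have -> : U :&: [set v | locally_sparse E U v] = [set v in U | locally_sparse E U v].
      by apply/setP => v; rewrite !inE.
    have -> : U :\: [set v | locally_sparse E U v] = [set v in U | ~~ locally_sparse E U v].
      by apply/setP => v; rewrite !inE andbC.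
    by rewrite addrK.
  pose hit v : R := avg E U (fun W => M * (v \in W)%:R).
  apply: (@le_trans _ _ (\sum_(v in U) (hit v + kill U v))).
    rewrite mulr_natr -sumr_const big_mkcond [leRHS]big_mkcond; apply: ler_sum => v _.
    rewrite inE; case: ifP => [/andP[vU sp]|_]; last first.
      case: (v \in U) => //; rewrite addr_ge0 // /hit /avg divr_ge0 // sumr_ge0 // => W _.
      exact: mulr_ge0.
    rewrite vU /hit /kill /avg -mulrDl -big_split /= ler_pdivlMr ?indep_subsets_gt0 //.
    by apply: local_bound => // e eE _; apply: card_edge.
  rewrite big_split /=; apply: lerD => //.
  rewrite /hit /avg -mulr_suml exchange_big /=; apply: (avg_le card_edge) => W.
  rewrite inE => /andP[_ /hs Ws]; rewrite -mulr_sumr; apply: ler_wpM2l => //.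
  rewrite -natr_sum ler_nat; apply: leq_trans Ws.
  rewrite -sum1_card big_mkcond [leqRHS]big_mkcond; apply: leq_sum => v _.
  by case: (v \in U); case: (v \in W).
have avgS : \sum_(U : {set V}) wt q U * (L * (#|U|%:R - #|[set v in U | ~~ locally_sparse E U v]|%:R))
   <= \sum_(U : {set V}) wt q U * (M * s%:R + \sum_(v in U) kill U v).
  by apply: ler_sum => U _; apply: ler_wpM2l.
have lhs : \sum_(U : {set V}) wt q U * (L * (#|U|%:R - #|[set v in U | ~~ locally_sparse E U v]|%:R))
   = L * (q * #|V|%:R - \sum_(U : {set V}) wt q U * #|[set v in U | ~~ locally_sparse E U v]|%:R).
  rewrite -sum_wt_card -sumrB mulr_sumr; apply: eq_bigr => U _; ring.
have rhs : \sum_(U : {set V}) wt q U * (M * s%:R + \sum_(v in U) kill U v)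
   <= M * s%:R + 2 * q * (d * 'C(s, 3))%:R.
  under eq_bigr => U _ do rewrite mulrDr.
  rewrite big_split /= -mulr_suml sum_wt_all mul1r lerD2l.
  exact: sum_avg_kills_le.
apply: le_trans (le_trans avgS rhs); rewrite lhs; apply: ler_wpM2l => //.
have := sum_unsparse_le q0 q2 nq.
set bad := \sum_(U : {set V}) _ => bad_le.
suff : bad <= q * #|V|%:R / 2 by lra.
apply: le_trans bad_le _.
have c0 : 0 <= q * #|V|%:R / 2 by rewrite !mulr_ge0 ?invr_ge0 // ltW.
have := ler_wpM2l c0 nq'; rewrite mulr1; apply: le_trans.
by rewrite le_eqVlt; apply/orP; left; apply/eqP; field.
Qed.

End Sparseness.

(** * Order of a hypergraph with small independence number *)

Lemma six_bin3_le s : 6 * 'C(s, 3) <= s ^ 3.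
Proof.
rewrite mulnC -[6]/(3`!) bin_ffact /falling_factorial /=.
by case: s => [//|s]; rewrite /ffact_rec /= !muln1 !expnS expn0; nia.
Qed.

Lemma add_three_bin3_le w : w + 3 * 'C(w, 3) <= w ^ 3.
Proof.
have := six_bin3_le w; case: w => [|[|w]] h; try by rewrite bin_small.
suff : 2 * w.+2 <= w.+2 ^ 3 by lia.
by rewrite !expnS expn0; nia.
Qed.

Section IndependenceNumber.
Variables (V : finType) (E : {set {set V}}).
Hypothesis card_edge : forall e, e \in E -> #|e| = 4.
Hypothesis codegree :
  forall T : {set V}, #|T| = 3 -> #|[set e in E | T \subset e]| <= 3.

(** For a largest independent set [W], every other vertex completes an edge with a triple of [W],
    and each triple serves at most three vertices. *)
Lemma order_le_cube s : 0 < s -> (forall W, independent E W -> #|W| <= s) -> #|V| <= s ^ 3.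
Proof.
move=> s0 hs.
have i0 : independent E set0.
  apply/independentP => e eE; rewrite subset0 => /eqP e0.
  by have := card_edge eE; rewrite e0 cards0.
case: (@arg_maxnP _ set0 (independent E) (fun W => #|W|) i0) => W iW maxW.
have killed v : v \notin W -> 0 < kills E W v.
  move=> vW; rewrite card_gt0; apply/set0Pn.
  have : ~~ independent E (v |: W).
    by apply/negP => /maxW; rewrite /= cardsU1 vW /geq /= ltnn.
  case/forall_inPn => e eE /negPn eW; exists e; rewrite inE eE /=.
  apply/andP; split; last by rewrite subDset.
  apply: contraT => ve; exfalso; apply: (independentP _ _ iW e eE).
  apply/subsetP => u ue; have /setU1P[uv|//] := subsetP eW u ue.
  by rewrite uv (negPf ve) in ue.
have : #|~: W| <= 3 * 'C(#|W|, 3).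
  apply: leq_trans (sum_kills_le card_edge codegree W).
  rewrite -sum1_card big_mkcond; apply: leq_sum => v _.
  by rewrite inE; case: ifP => // /killed.
rewrite -(cardsC W) => c1.
apply: leq_trans (_ : #|W| ^ 3 <= _); last by rewrite leq_exp2r // hs.
by apply: leq_trans (add_three_bin3_le _); rewrite leq_add2l.
Qed.

Local Open Scope ring_scope.

(* With [w = s ^ (1/36)] the density is [q = w ^- 68 = s ^ (-17/9)]: small enough
   for [#|V| ^ 5 * q ^ 8], which bounds the proportion of unsparse vertices, to
   vanish, and large enough for [M = q * #|V| / s] to be a power of [s]. *)
Lemma order_le_cube_div_ln (R : realType) (s : nat) :
    10 ^+ 9 <= ln (s%:R : R) ->
    (forall W, independent E W -> (#|W| <= s)%N) ->
  #|V|%:R <= 2304 / ln (s%:R : R) * s%:R ^+ 3.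
Proof.
set t := ln (s%:R : R) => t0 hs.
have t1 : 10 ^+ 3 <= t by lra.
have s0 : (0 < s)%N.
  by rewrite lt0n; apply/eqP => s0; move: t1; rewrite /t s0 ln0 //; lra.
have sE : s%:R = expR t by rewrite lnK // posrE ltr0n.
pose w := expR (t / 36).
have wX m : w ^+ m = expR (m%:R * (t / 36)) by rewrite expRM_natl.
have w36 : w ^+ 36 = s%:R by rewrite sE wX; congr expR; lra.
have tw : t / 36 <= w by have := expR_ge1Dx (t / 36); rewrite -/w; lra.
have w1 : 10 ^+ 7 <= w by lra.
have w0 : 0 < w by apply: expR_gt0.
have tw2 : t <= w ^+ 2.
  apply: (@le_trans _ _ ((t / 36) ^+ 2)); first by nra.
  by rewrite lerXn2r ?nnegrE //; lra.
set n : R := #|V|%:R.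
have n_le : n <= w ^+ 108.
  rewrite (_ : 108 = 36 * 3)%N // exprM w36 -natrX ler_nat.
  exact: order_le_cube.
(* Below this value the claim is immediate; above it, [t <= w ^+ 2] gives [n >= w ^+ 106]. *)
have [small|n_ge] := leP n (w ^+ 108 / t).
  apply: le_trans small _; rewrite (_ : 108 = 36 * 3)%N // exprM w36.
  rewrite mulrC; apply: ler_wpM2r; first exact: exprn_ge0.
  rewrite -[leLHS]mul1r; apply: ler_wpM2r; last lra.
  by rewrite invr_ge0; lra.
have {}n_ge : w ^+ 106 <= n.
  apply: le_trans (ltW n_ge); rewrite ler_pdivlMr; last lra.
  by rewrite (_ : 108 = 106 + 2)%N // exprD; apply: ler_wpM2l; rewrite // exprn_ge0 ?ltW.
have wX0 m : 0 < w ^+ m by apply: exprn_gt0.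
have wn0 m : w ^+ m != 0 by rewrite lt0r_neq0.
have w_le m : w <= w ^+ m.+1 by rewrite -[leLHS]expr1 ler_weXn2l //; lra.
have n0 : 0 <= n by rewrite ler0n.
have qX m : (w ^- 68) ^+ m = (w ^+ (68 * m))^-1 by rewrite exprVn exprM.
have q1 : w ^- 68 <= 1 / 2.
  rewrite -[leLHS]mul1r ler_pdivrMr //.
  have := w_le 67; lra.
have nq1 : 1 <= n ^+ 2 * (w ^- 68) ^+ 3.
  rewrite qX ler_pdivlMr // mul1r.
  apply: (@le_trans _ _ ((w ^+ 106) ^+ 2)).
    by rewrite -exprM ler_weXn2l //; lra.
  by rewrite lerXn2r ?nnegrE // ltW.
(* [5 * 108 + 1 <= 68 * 8]; the extra factor [w >= 10 ^+ 7] absorbs the constant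
   [2 * 10 ^+ 5 * 27]. *)
have nq2 : 2 * 10 ^+ 5 * 3%:R ^+ 3 * n ^+ 5 * (w ^- 68) ^+ 8 <= 1.
  rewrite qX ler_pdivrMr // mul1r.
  apply: (@le_trans _ _ (w * (w ^+ 108) ^+ 5)).
    apply: ler_pM; rewrite ?exprn_ge0 //; first lra.
      lra.
    by rewrite lerXn2r ?nnegrE // ltW.
  by rewrite -exprM -exprS ler_weXn2l //; lra.
have s0' : 0 < s%:R :> R by rewrite ltr0n.
pose M := w ^- 68 * n / s%:R.
have M_ge : w ^+ 2 <= M.
  rewrite /M ler_pdivlMr // -w36 -exprD ler_pdivlMl // -exprD.
  by apply: le_trans n_ge; rewrite ler_weXn2l //; lra.
(* The left side is one eighth of [t / 36]. If [y >= t / 36] the second term suffices; otherwise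
   [2 ^+ y <= expR y <= w], so the first is at least [w >= t / 36]. *)
have ML (y : nat) : 2 * (t / 576) <= M * 2 ^- y + y%:R / 8.
  have y0 : 0 <= y%:R :> R by rewrite ler0n.
  have M0 : 0 <= M * 2 ^- y.
    by rewrite mulr_ge0 ?invr_ge0 ?exprn_ge0 //; apply: le_trans M_ge; apply: ltW.
  have [y_ge|y_lt] := leP (t / 36) y%:R; first lra.
  have y2 : 2 ^+ y <= w.
    apply: (@le_trans _ _ (expR 1 ^+ y)).
      by rewrite lerXn2r ?nnegrE ?expR_ge0 //; have := expR_ge1Dx (1 : R); lra.
    by rewrite -expRM_natl mulr1 ler_expR ltW.
  suff : w <= M * 2 ^- y by lra.
  rewrite ler_pdivlMr ?exprn_gt0 //; apply: le_trans M_ge; rewrite expr2.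
  by apply: ler_wpM2l => //; apply: ltW.
have := independence_number_bound card_edge codegree _ q1 nq1 nq2 _ _ ML hs.
rewrite invr_gt0 => /(_ (wX0 _)).
have M0 : 0 <= M by apply: le_trans M_ge; apply: ltW.
move=> /(_ M0) /(_ (_ : 0 <= t / 576)) H.
have {H} : t / 576 * (w ^- 68 * n / 2) <= M * s%:R + 2 * w ^- 68 * (3 * 'C(s, 3))%:R.
  by apply: H; lra.
have -> : M * s%:R = w ^- 68 * n by rewrite /M divfK // lt0r_neq0.
have b3 : (3 * 'C(s, 3))%:R <= s%:R ^+ 3 / 2 :> R.
  rewrite ler_pdivlMr // -natrX -natrM ler_nat.
  by apply: leq_trans (six_bin3_le s); rewrite mulnAC.
set q := w ^- 68 => H.
have q0 : 0 < q by rewrite invr_gt0.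
have : q * (t / 1152 * n) <= q * (n + s%:R ^+ 3).
  have := ler_wpM2l (ltW q0) b3; lra.
rewrite ler_pM2l // => {}H.
rewrite mulrAC ler_pdivlMr; last lra.
(* As [t >= 2304], the [n] on the right of [H] is at most half of the left side; this turns 1152
   into 2304. *)
have : 2 * n <= t / 1152 * n by apply: ler_wpM2r => //; lra.
lra.
Qed.

End IndependenceNumber.

(** * Rainbow cliques *)

(** An injection given as a relation, so that partners may come from a bare existence statement. *)
Lemma leq_card_rel (T T' : finType) (A : {set T}) (B : {set T'})
    (r : T -> T' -> Prop) :
    (forall x, x \in A -> exists2 y, y \in B & r x y) ->
    (forall x x' y, x \in A -> x' \in A -> r x y -> r x' y -> x = x') ->
  #|A| <= #|B|.
Proof.
move=> rA r_inj.
pose h x := [pick y in B | `[< r x y >]].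
have hP x : x \in A -> exists2 y, h x = Some y & y \in B /\ r x y.
  move=> /rA[y yB rxy]; rewrite /h; case: pickP => [z /andP[zB /asboolP rxz]|none].
    by exists z.
  by have := none y; rewrite yB => /negbT/asboolP.
rewrite -[X in X <= _](card_in_imset (f := h)); last first.
  move=> x x' xA x'A eqh; have [y hy [_ rxy]] := hP x xA.
  have [y' hy' [_ rxy']] := hP x' x'A.
  by move: eqh; rewrite hy hy' => -[yy']; apply: (r_inj _ _ y); rewrite // yy'.
rewrite -[X in _ <= X](card_imset B (f := Some)); last by move=> ? ? [].
apply: subset_leq_card; apply/subsetP => _ /imsetP[x xA ->].
by have [y -> [yB _]] := hP x xA; apply: imset_f.
Qed.

Section EdgesIn.
Variable V : finType.
Implicit Types (Q S A e f g : {set V}) (G : {set {set V}}).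

Definition edges_in Q : {set {set V}} := [set e in complete_graph V | e \subset Q].

Lemma edges_inE Q e : (e \in edges_in Q) = (#|e| == 2) && (e \subset Q).
Proof. by rewrite !inE. Qed.

Lemma edges_inS Q S : Q \subset S -> edges_in Q \subset edges_in S.
Proof.
move=> QS; apply/subsetP => e; rewrite !edges_inE => /andP[-> eQ] /=.
exact: subset_trans QS.
Qed.

Lemma edges_in_setT : edges_in setT = complete_graph V.
Proof. by apply/setP => e; rewrite edges_inE subsetT inE andbT. Qed.

Lemma card_edges_in Q : #|edges_in Q| = 'C(#|Q|, 2).
Proof.
by rewrite -cards_draws; apply: eq_card => e; rewrite edges_inE inE andbC.
Qed.

Lemma edge_cons e v : #|e| = 2 -> v \in e -> exists2 x, x != v & e = [set v; x].
Proof.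
move=> /eqP/cards2P[x [y [xy ->]]]; rewrite !inE => /orP[]/eqP->.
  by exists y; rewrite // eq_sym.
by exists x => //; rewrite setUC.
Qed.

Lemma proper_edge_colouringS G G' (C : Type) (c : {set V} -> C) :
  G \subset G' -> proper_edge_colouring G' c -> proper_edge_colouring G c.
Proof. by move=> /subsetP s pc e f /s eG /s fG; apply: pc. Qed.

Lemma rainbowS G G' (C : Type) (c : {set V} -> C) :
  G \subset G' -> rainbow G' c -> rainbow G c.
Proof. by move=> /subsetP s rb e f /s eG /s fG; apply: rb. Qed.

Lemma not_rainbow G (C : Type) (c : {set V} -> C) : ~ rainbow G c ->
  exists e f, [/\ e \in G, f \in G, e != f & c e = c f].
Proof.
move=> nr; apply: contrapT => H; apply: nr => e f eG fG cef.
by apply: contrapT => /eqP ef; apply: H; exists e, f.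
Qed.

Lemma proper_disjoint G (C : Type) (c : {set V} -> C) e f :
  proper_edge_colouring G c -> e \in G -> f \in G -> e != f -> c e = c f ->
  [disjoint e & f].
Proof. by move=> pc eG fG ef cef; apply: contraT => /(pc e f eG fG ef). Qed.

Lemma star_injective G (C : Type) (c : {set V} -> C) x y z :
  proper_edge_colouring G c -> [set x; y] \in G -> [set x; z] \in G ->
  y != x -> z != x -> c [set x; y] = c [set x; z] -> y = z.
Proof.
move=> pc yG zG yx zx cyz; apply: contrapT => /eqP yz.
have d : [disjoint [set x; y] & [set x; z]].
  apply: (proper_disjoint pc) => //; apply: contraNneq yz => /setP/(_ y).
  by rewrite !inE eqxx orbT (negPf yx) /= => /esym.
by have := disjointFr d (set21 x y); rewrite set21.
Qed.

Section Conflicts.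
Variables (C : Type) (c : {set V} -> C).
Hypothesis c_proper : proper_edge_colouring (complete_graph V) c.

(** A proper colouring repeats a colour only on disjoint edges, so a clique that is not rainbow
    contains one of these four-sets. *)
Definition conflicts : {set {set V}} :=
  [set S : {set V} | `[< exists e f, [/\ #|e| = 2, #|f| = 2, [disjoint e & f],
                                 c e = c f & S = e :|: f] >]].

Lemma card_conflict S : S \in conflicts -> #|S| = 4.
Proof.
rewrite inE => /asboolP[e [f [e2 f2 d _ ->]]].
by rewrite cardsU (disjoint_setI0 d) cards0 e2 f2.
Qed.

(** In an edge [w |: S], some [x] in [S] is joined to [w] in the colour of [S :\ x]; at [x] this
    colour determines [w]. Hence at most one edge for each of the three [x]. *)
Lemma conflict_codegree S : #|S| = 3 -> #|[set e in conflicts | S \subset e]| <= 3.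
Proof.
move=> S3; rewrite -[X in _ <= X]S3.
apply: (leq_card_rel (r := fun e x => exists w,
  [/\ x \in S, w \notin S, e = w |: S & c [set x; w] = c (S :\ x)])).
  move=> e; rewrite inE => /andP[eC Se]; have e4 := card_conflict eC.
  have /set0Pn[w] : e :\: S != set0.
    by rewrite -card_gt0 cardsD (setIidPr Se) e4 S3.
  rewrite inE => /andP[wS we].
  have eE : e = w |: S.
    by apply/esym/eqP; rewrite eqEcard subUset sub1set we Se e4 cardsU1 wS S3.
  move: eC; rewrite inE => /asboolP[f [g [f2 g2 d cfg eU]]].
  wlog wf : f g f2 g2 d cfg eU / w \in f.
    move=> H; have : w \in f :|: g by rewrite -eU.
    case/setUP => [wf|wg]; first exact: (H f g).
    by apply: (H g f); rewrite // 1?disjoint_sym // setUC.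
  have [x xw fE] := edge_cons f2 wf.
  have xS : x \in S.
    have : x \in w |: S by rewrite -eE eU fE !inE eqxx orbT.
    by rewrite !inE (negPf xw).
  exists x => //; exists w; split=> //.
  rewrite setUC -fE cfg; congr c; apply/setP => u.
  have := congr1 (fun T : {set V} => u \in T) eU.
  have := disjointFr d (x := u).
  rewrite eE fE !inE; have [->|uw] := eqVneq u w; first by rewrite (negPf wS) andbF /= => ->.
  by have [->|ux] := eqVneq u x => /= [->|_ ->].
move=> e e' x _ _ [w [xS wS -> cw]] [w' [_ wS' -> cw']]; congr (_ |: _).
have neq u : u \notin S -> u != x by apply: contraNneq => ->.
have edge u : u \notin S -> [set x; u] \in complete_graph V.
  by move=> uS; rewrite inE cards2 eqSS eqb1 eq_sym neq.
apply: (star_injective c_proper (edge _ wS) (edge _ wS') (neq _ wS) (neq _ wS')).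
by rewrite cw.
Qed.

Lemma rainbow_independent W : independent conflicts W -> rainbow (edges_in W) c.
Proof.
move=> iW; apply: contrapT => /not_rainbow[e [f [eW fW ef cef]]].
have [eK fK] : e \in complete_graph V /\ f \in complete_graph V.
  by move: eW fW; rewrite !inE => /andP[-> _] /andP[-> _].
move: eW fW; rewrite !edges_inE => /andP[/eqP e2 eW] /andP[/eqP f2 fW].
apply: (independentP _ _ iW (e :|: f)); last by rewrite subUset eW.
rewrite inE; apply/asboolP; exists e, f; split=> //.
exact: (proper_disjoint c_proper).
Qed.

End Conflicts.

(** As [Q] is rainbow, one of two edges of equal colour is some [[set y; x]]; the other is disjoint
    from it by properness, so it lies in [Q] without [x]. *)
Lemma conflict_in_rainbow_extension G (C : Type) (c : {set V} -> C) Q y :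
    proper_edge_colouring G c -> edges_in (y |: Q) \subset G -> y \notin Q ->
    rainbow (edges_in Q) c -> ~ rainbow (edges_in (y |: Q)) c ->
  exists x f, [/\ x \in Q, f \in edges_in (Q :\ x) & c [set y; x] = c f].
Proof.
move=> pc sub yQ rb /not_rainbow[e [f [eQ fQ ef cef]]].
have d := proper_disjoint pc (subsetP sub _ eQ) (subsetP sub _ fQ) ef cef.
wlog ye : e f eQ fQ ef cef d / y \in e.
  move=> H; have [ye|ye] := boolP (y \in e); first exact: (H e f).
  have [yf|yf] := boolP (y \in f).
    by apply: (H f e); rewrite // 1?disjoint_sym // eq_sym.
  have inQ g : g \in edges_in (y |: Q) -> y \notin g -> g \in edges_in Q.
    rewrite !edges_inE => /andP[-> /subsetP gQ] yg; apply/subsetP => u ug.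
    by have /setU1P[uy|//] := gQ u ug; rewrite -uy ug in yg.
  by case/eqP: ef; apply: rb => //; apply: inQ.
move: eQ fQ; rewrite !edges_inE => /andP[/eqP e2 /subsetP eQ] /andP[f2 /subsetP fQ].
have [x xy eE] := edge_cons e2 ye.
exists x, f; split.
- have xe : x \in e by rewrite eE set22.
  by have /setU1P[xy'|//] := eQ x xe; rewrite xy' eqxx in xy.
- rewrite edges_inE f2; apply/subsetP => u uf; rewrite in_setD1.
  have := disjointFl d uf; rewrite eE !inE => /norP[uy ux]; rewrite ux.
  by have /setU1P[uy'|//] := fQ u uf; rewrite uy' eqxx in uy.
- by rewrite -eE.
Qed.

End EdgesIn.

(** * Transport of cliques along injections *)

Section Transport.
Variables (T V : finType) (phi : T -> V).
Hypothesis phi_inj : injective phi.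

Lemma edges_in_imset (S : {set T}) :
  [set phi @: (e : {set T}) | e in edges_in S] = edges_in (phi @: S).
Proof.
apply/setP => e; apply/imsetP/idP => [[e0 + ->]|].
  rewrite !edges_inE card_imset // => /andP[-> /=]; exact: imsetS.
rewrite edges_inE => /andP[e2 /subsetP eS].
have eE : e = phi @: (phi @^-1: e).
  apply/setP => v; apply/idP/imsetP => [ve|[t]]; last by rewrite inE => ? ->.
  by have /imsetP[t _ vt] := eS v ve; exists t; rewrite // inE -vt.
exists (phi @^-1: e) => //; rewrite edges_inE -(card_imset _ phi_inj) -eE e2.
by apply/subsetP => t; rewrite inE => /eS; rewrite mem_imset.
Qed.

Variables (C : Type) (c : {set V} -> C).

Lemma rainbow_imset (S : {set T}) :
  rainbow (edges_in S) (fun e => c (phi @: e)) <-> rainbow (edges_in (phi @: S)) c.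
Proof.
rewrite -edges_in_imset; split=> rb => [_ _ /imsetP[e eS ->] /imsetP[f fS ->] /(rb e f eS fS) ->//|].
move=> e f eS fS cef; apply: (imset_inj phi_inj).
by apply: rb; rewrite ?imset_f.
Qed.

Lemma proper_imset (S : {set T}) : proper_edge_colouring (edges_in (phi @: S)) c ->
  proper_edge_colouring (edges_in S) (fun e => c (phi @: e)).
Proof.
rewrite -edges_in_imset => pc e f eS fS ef nd; apply: pc; rewrite ?imset_f //.
  by apply: contraNneq ef => /(imset_inj phi_inj) ->.
apply: contraNN nd; rewrite -!setI_eq0 -imsetI; last by move=> ? ? _ _; apply: phi_inj.
by rewrite imset_eq0.
Qed.

End Transport.

Lemma has_rainbow_cliqueP (V : finType) (k : nat) (G : {set {set V}}) (C : Type)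
    (c : {set V} -> C) :
  has_rainbow_copy (complete_graph 'I_k) G c <->
  exists Q : {set V}, [/\ #|Q| = k, edges_in Q \subset G & rainbow (edges_in Q) c].
Proof.
split=> [[phi [phi_inj]]|[Q [Qk]]].
  rewrite -edges_in_setT edges_in_imset // => sub rb.
  by exists (phi @: setT); split; rewrite // card_imset // cardsT card_ord.
move: (@enum_val_inj _ (mem Q)) (@enum_valP _ (mem Q)); move: (@enum_val _ (mem Q)).
rewrite Qk => phi phi_inj phiQ.
have -> : Q = phi @: setT.
  apply/esym/eqP; rewrite eqEcard card_imset // cardsT card_ord Qk leqnn andbT.
  by apply/subsetP => _ /imsetP[i _ ->]; apply: phiQ.
by move=> sub rb; exists phi; rewrite -edges_in_setT edges_in_imset.
Qed.

(** The clique of the construction has [m] vertices where this fails at [m] and holds at [m.+1],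
    with [j = k - 1]. *)
Definition forces_rainbow (m j : nat) : Prop :=
  forall (C : Type) (c : {set 'I_m} -> C),
    proper_edge_colouring (complete_graph 'I_m) c ->
  exists2 Q : {set 'I_m}, #|Q| = j & rainbow (edges_in Q) c.

Lemma forces_rainbow_in (V : finType) (A : {set V}) (m j : nat) (C : Type)
    (c : {set V} -> C) :
    forces_rainbow m j -> #|A| = m -> proper_edge_colouring (edges_in A) c ->
  exists Q : {set V}, [/\ Q \subset A, #|Q| = j & rainbow (edges_in Q) c].
Proof.
move=> fm Am.
move: (@enum_val_inj _ (mem A)) (@enum_valP _ (mem A)); move: (@enum_val _ (mem A)).
rewrite Am => phi phi_inj phiA.
have -> : A = phi @: setT.
  apply/esym/eqP; rewrite eqEcard card_imset // cardsT card_ord Am leqnn andbT.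
  by apply/subsetP => _ /imsetP[i _ ->]; apply: phiA.
move=> /(proper_imset phi_inj); rewrite edges_in_setT => /fm[Q Qj rb].
exists (phi @: Q); split; first by rewrite imsetS ?subsetT.
  by rewrite card_imset.
exact/rainbow_imset.
Qed.

(** * Saturated graphs above a clique joined to an independent set *)

Section Saturation.
Variables (n : nat) (A : {set 'I_n}).
Local Notation V := 'I_n.
Implicit Types (G : {set {set V}}).

Definition meeting : {set {set V}} := complete_graph V :\: edges_in (~: A).

Lemma meetingE e : (e \in meeting) = (#|e| == 2) && ~~ [disjoint e & A].
Proof.
rewrite inE edges_inE inE negb_and -disjoints_subset.
by case: (#|e| == 2); rewrite ?andbF ?andbT.
Qed.

Lemma edge_meeting x y : x != y -> x \in A -> [set x; y] \in meeting.
Proof.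
move=> xy xA; rewrite meetingE cards2 xy /=; apply/pred0Pn; exists x.
by rewrite /= set21.
Qed.

(** Weaker than containing no [K_k]: some proper colouring has to avoid rainbow copies. *)
Definition clique_free (k : nat) G : Prop := is_graph G /\
  exists (C : Type) (c : {set V} -> C),
    proper_edge_colouring G c /\ ~ has_rainbow_copy (complete_graph 'I_k) G c.

(** In a largest such graph above [G], a good colouring after adding an edge would contradict
    maximality. *)
Lemma saturated_supergraph k G : clique_free k G ->
  exists2 G' : {set {set V}}, G \subset G' &
    clique_free k G' /\ rainbow_saturated (complete_graph 'I_k) G'.
Proof.
move=> fG; pose good (G' : {set {set V}}) := `[< clique_free k G' >] && (G \subset G').
have good0 : good G by rewrite /good subxx andbT; apply/asboolP.
case: (@arg_maxnP _ G good (fun G => #|G|) good0) => G' /andP[/asboolP fG' sub] maxG.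
exists G' => //; split=> //; case: (fG') => gG' colG'; split=> // e.
rewrite inE => /andP[eG eK] C c pc; apply: contrapT => noH.
have : good (e |: G').
  apply/andP; split; last by apply: subset_trans sub (subsetUr _ _).
  apply/asboolP; split; last by exists C, c.
  by apply/subsetP=> f /setU1P [->//|/(subsetP gG')].
by move/maxG; rewrite cardsU1 eG /= add1n /geq /= ltnn.
Qed.

(* Edges inside [A] get the colours of a colouring of [K_m] without a rainbow
   clique on [k - 1] vertices, all others get private colours; a clique has at
   most one vertex outside [A]. *)
Lemma clique_free_meeting (m k : nat) (w : 'I_m -> V) :
  injective w -> A = w @: setT -> ~ forces_rainbow m k.-1 -> clique_free k meeting.
Proof.
move=> w_inj AE nf; split; first by apply: subsetDl.
move: nf => /existsNP[C /existsNP[c0 /not_implyP[pc0 nrb]]].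
pose c (e : {set V}) : C + {set V} :=
  if e \subset A then inl (c0 (w @^-1: e)) else inr e.
have wK (e : {set 'I_m}) : w @^-1: (w @: e) = e by apply/setP => x; rewrite inE mem_imset.
have cw (e : {set 'I_m}) : c (w @: e) = inl (c0 e) by rewrite /c AE imsetS ?subsetT // wK.
exists (C + {set V})%type, c; split.
  move=> e f; rewrite !meetingE => /andP[e2 _] /andP[f2 _] ef nd.
  rewrite /c; case: ifPn => eA; case: ifPn => fA //; last first.
    by case=> efE; rewrite efE eqxx in ef.
  case.
  have eI : e \in edges_in A by rewrite edges_inE e2.
  have fI : f \in edges_in A by rewrite edges_inE f2.
  rewrite AE -edges_in_imset // edges_in_setT in eI fI.
  case/imsetP: eI => e0 e0K eE; case/imsetP: fI => f0 f0K fE.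
  rewrite eE fE !wK; apply: pc0 => //.
    by apply: contraNneq ef => ef0; rewrite eE fE ef0.
  by apply: contraNN nd; rewrite -!setI_eq0 eE fE -imsetI ?imset_eq0 // => ? ? _ _; apply: w_inj.
move=> /has_rainbow_cliqueP[Q [Qk sub rb]]; apply: nrb.
have QA : #|Q :\: A| <= 1.
  rewrite leqNgt; apply/negP => /card_gt1P[x [y [+ + xy]]].
  rewrite !inE => /andP[xA xQ] /andP[yA yQ].
  have : [set x; y] \in meeting.
    apply: (subsetP sub); rewrite edges_inE cards2 xy subUset !sub1set.
    by rewrite xQ.
  rewrite meetingE => /andP[_ /pred0Pn[z /andP[/=]]]; rewrite !inE.
  by case/orP=> /eqP ->; apply/negP.
have : k.-1 <= #|Q :&: A|.
  have := subset_leq_card (subsetDl Q A); rewrite Qk => QAk.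
  rewrite -(leq_add2r #|Q :\: A| k.-1) cardsID Qk.
  by case: (k) QAk QA => [|k'] /=; lia.
case/card_geqP => s [us ss sub_s].
pose Q1 := [set x in s].
have Q1A : Q1 \subset Q :&: A by apply/subsetP => x; rewrite inE => /sub_s.
have Q1E : Q1 = w @: (w @^-1: Q1).
  apply/setP => v; apply/idP/imsetP => [vQ|[t]]; last by rewrite inE => ? ->.
  have := subsetP Q1A v vQ; rewrite AE => /setIP[_ /imsetP[t _ vt]].
  by exists t; rewrite // inE -vt.
exists (w @^-1: Q1); first by rewrite -(card_imset _ w_inj) -Q1E cardsE (card_uniqP us).
have rbw : rainbow (edges_in (w @^-1: Q1)) (fun e => c (w @: e)).
  apply/(rainbow_imset w_inj); rewrite -Q1E; apply: rainbowS rb.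
  by apply: edges_inS; apply: subset_trans Q1A (subsetIl _ _).
by move=> e f eQ fQ cef; apply: rbw => //=; rewrite !cw cef.
Qed.

(* A rainbow clique [Q] on [k - 1] vertices in [v |: A] forbids every other
   vertex of [v |: A] and every outer neighbour of [v]: the colour from it to some
   [x] in [Q] recurs on an edge of [Q] avoiding [x]. *)
Lemma outer_degree_le (m k : nat) G v : 0 < k ->
    #|A| = m -> forces_rainbow m.+1 k.-1 -> meeting \subset G -> clique_free k G ->
    v \notin A ->
  #|[set e in G | (v \in e) && [disjoint e & A]]| + (m.+1 - k.-1)
    <= k.-1 * 'C(k.-2, 2).
Proof.
move=> k0 Am fm sub [gG [C [c [pc nrb]]]] vA.
have subvA : edges_in (v |: A) \subset G.
  apply: subset_trans sub; apply/subsetP => e; rewrite edges_inE meetingE.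
  case/andP => e2 /subsetP evA; rewrite e2 /=.
  case/cards2P: e2 => x [y [xy eE]].
  have [xe ye] : x \in e /\ y \in e by rewrite eE set21 set22.
  apply/pred0Pn; case/setU1P: (evA x xe) => [xv|xA]; last by exists x; rewrite /= xe.
  exists y; rewrite /= ye; case/setU1P: (evA y ye) => [yv|//].
  by rewrite xv yv eqxx in xy.
have vA1 : #|v |: A| = m.+1 by rewrite cardsU1 vA Am.
have [Q [QvA Qk rbQ]] := forces_rainbow_in fm vA1 (proper_edge_colouringS subvA pc).
(* [W] consists of the outer neighbours of [v]; the vertices of [Y] lie outside [Q] and are adjacent
   to all of [Q]. *)
pose W := [set u | [&& u \notin A, u != v & [set v; u] \in G]].
pose Y := ((v |: A) :\: Q) :|: W.
have WvA : [disjoint v |: A & W].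
  rewrite -setI_eq0; apply/eqP/setP => u; rewrite !inE.
  by case: eqVneq => [->|]; [rewrite andbF|case: (u \in A)].
have cardY : #|Y| = m.+1 - k.-1 + #|W|.
  rewrite cardsU disjoint_setI0; last by apply: disjointWl WvA; apply: subsetDl.
  by rewrite cards0 subn0 cardsD (setIidPr QvA) vA1 Qk.
have YQ (y : V) : y \in Y -> y \notin Q.
  case/setUP => [/setDP[]//|yW]; apply/negP => /(subsetP QvA).
  by move/(disjointFr WvA); rewrite yW.
have GY (y x : V) : y \in Y -> x \in Q -> [set y; x] \in G.
  move=> yY xQ; have yQ := YQ y yY.
  have yx : y != x by apply: contraNneq yQ => ->.
  have /setU1P[xv|xA] := subsetP QvA x xQ; last first.
    by apply: (subsetP sub); rewrite setUC edge_meeting // eq_sym.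
  have : y \in A \/ y \in W.
    case/setUP: yY => [/setDP[/setU1P[yv|yA] _]|]; [|by left|by right].
    by rewrite yv xv eqxx in yx.
  case=> [yA|]; first by apply: (subsetP sub); rewrite edge_meeting.
  by rewrite inE setUC xv => /and3P[].
have YG (y : V) : y \in Y -> edges_in (y |: Q) \subset G.
  move=> yY; apply/subsetP => e; rewrite edges_inE => /andP[e2 /subsetP eQ].
  have [ye|ye] := boolP (y \in e).
    have [x xy eE] := edge_cons (eqP e2) ye; rewrite eE; apply: GY => //.
    have xe : x \in e by rewrite eE set22.
    by have /setU1P[xy'|//] := eQ x xe; rewrite xy' eqxx in xy.
  apply: (subsetP subvA); rewrite edges_inE e2; apply/subsetP => u ue.
  apply: (subsetP QvA); have /setU1P[uy|//] := eQ u ue.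
  by rewrite -uy ue in ye.
(* The possible conflicts: a vertex [x] of [Q] and an edge of [Q] avoiding it. A pair serves only
   one [y], which is determined by the colour of its edge to [x]. *)
pose P := [set p : V * {set V} | (p.1 \in Q) && (p.2 \in edges_in (Q :\ p.1))].
have cardP : #|P| = k.-1 * 'C(k.-2, 2).
  rewrite -sum1_card (eq_bigl (fun p : V * {set V} => (p.1 \in Q) && (p.2 \in edges_in (Q :\ p.1)))); last first.
    by move=> p; rewrite inE.
  rewrite -(pair_big_dep (fun x => x \in Q) (fun x f => f \in edges_in (Q :\ x)) (fun _ _ => 1)) /=.
  rewrite -Qk -sum_nat_const; apply: eq_bigr => x xQ.
  by rewrite sum1_card card_edges_in (cardsD1 x Q) xQ.
have YP : #|Y| <= #|P|.
  apply: (leq_card_rel (r := fun y p => p.1 \in Q /\ c [set y; p.1] = c p.2)).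
    move=> y yY; have yQ := YQ y yY.
    have [|x [f [xQ fQ cxf]]] := conflict_in_rainbow_extension pc (YG y yY) yQ rbQ.
      move=> rb; apply: nrb; apply/has_rainbow_cliqueP; exists (y |: Q); split=> //.
        by rewrite cardsU1 yQ Qk; case: (k) k0.
      exact: YG.
    by exists (x, f); first by rewrite inE /= xQ fQ.
  move=> y y' [x f] yY y'Y /= [xQ cy] [_ cy'].
  apply: (star_injective pc (x := x)).
  - by rewrite setUC GY.
  - by rewrite setUC GY.
  - by apply: contraNneq (YQ y yY) => ->.
  - by apply: contraNneq (YQ y' y'Y) => ->.
  - by rewrite ![[set x; _]]setUC cy cy'.
have XW : #|[set e in G | (v \in e) && [disjoint e & A]]| <= #|W|.
  apply: leq_trans (leq_imset_card (fun u => [set v; u]) _).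
  apply: subset_leq_card; apply/subsetP => e; rewrite inE => /and3P[eG ve eA].
  have e2 : #|e| = 2 by apply/eqP; have := subsetP gG e eG; rewrite inE.
  have [u uv eE] := edge_cons e2 ve; apply/imsetP; exists u => //.
  rewrite inE uv -eE eG !andbT; apply/negP => uA.
  by have := disjointFl eA uA; rewrite eE set22.
by rewrite -cardP; apply: leq_trans YP; rewrite cardY addnC leq_add2l.
Qed.

Lemma card_meeting : #|meeting| = 'C(#|A|, 2) + #|A| * (n - #|A|).
Proof.
have bin2D a b : 'C(a + b, 2) = 'C(a, 2) + a * b + 'C(b, 2).
  by elim: a => [|a IH]; rewrite // addSn !binS IH !bin1; lia.
have An : #|A| <= n by rewrite -[X in _ <= X]card_ord max_card.
have sub : edges_in (~: A) \subset complete_graph V.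
  by rewrite -edges_in_setT; apply/edges_inS/subsetT.
rewrite cardsD (setIidPr sub) -edges_in_setT !card_edges_in cardsT card_ord.
have -> : #|~: A| = n - #|A| by have := cardsC A; rewrite card_ord; lia.
by rewrite -{1}(subnKC An) bin2D addnK.
Qed.

(** Edges meeting [A] number at most [#|meeting|]; the others are counted by degrees, once at each
    end, which gives the half. *)
Lemma card_graph_le (D : nat) G : is_graph G ->
    (forall v, v \notin A -> #|[set e in G | (v \in e) && [disjoint e & A]]| <= D) ->
  #|G| <= 'C(#|A|, 2) + #|A| * (n - #|A|) + (D * (n - #|A|))./2.
Proof.
move=> gG degD; pose G2 := [set e in G | [disjoint e & A]].
have card2 e : e \in G -> #|e| = 2.
  by move=> eG; have := subsetP gG e eG; rewrite inE => /eqP.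
rewrite -(cardsID meeting G) -card_meeting; apply: leq_add.
  exact/subset_leq_card/subsetIr.
have -> : G :\: meeting = G2.
  apply/setP => e; rewrite in_setD meetingE inE andbC; case eG: (e \in G) => //=.
  by rewrite (card2 e eG) eqxx negbK.
rewrite geq_half_double -muln2 -sum_nat_const.
have -> : n - #|A| = #|~: A| by have := cardsC A; rewrite card_ord; lia.
rewrite mulnC -sum_nat_const.
apply: (@leq_trans (\sum_(e in G2) \sum_(v | v \in e) 1)).
  apply: leq_sum => e; rewrite inE => /andP[eG _].
  by rewrite sum1_card (card2 e eG).
rewrite (exchange_big_dep predT) //= [X in _ <= X]big_mkcond /=.
apply: leq_sum => v _; rewrite inE; case: ifPn => [vA|/negPn vA].
  apply: leq_trans (degD v vA); rewrite sum1_card.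
  by apply: subset_leq_card; apply/subsetP => e; rewrite unfold_in !inE -!andbA => /and3P[-> -> ->].
rewrite big1 // => e /andP[]; rewrite inE => /andP[_ eA] ve.
by rewrite (disjointFr eA ve) in vA.
Qed.

End Saturation.

(** The last hypothesis turns [outer_degree_le] into the bound [D] on outer degrees. [minn m n]
    covers [n <= m], where the formula reduces to the number of all edges. *)
Theorem rainbow_sat_clique_le (n k m D : nat) : 1 < k ->
    ~ forces_rainbow m k.-1 -> forces_rainbow m.+1 k.-1 ->
    k.-1 * 'C(k.-2, 2) <= D + (m.+1 - k.-1) ->
  rainbow_sat n (complete_graph 'I_k)
    <= 'C(minn m n, 2) + minn m n * (n - minn m n) + (D * (n - minn m n))./2.
Proof.
move=> k1 nf fm degD.
have K0 : complete_graph 'I_k != set0.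
  rewrite -edges_in_setT -card_gt0 card_edges_in cardsT card_ord bin_gt0.
  exact: k1.
have [[G0 [gG0 _ satE]] satP] := rainbow_satP n K0.
have [nm|mn] := leqP n m.
  rewrite subnn !muln0 !addn0 -satE.
  have := subset_leq_card gG0.
  by rewrite -edges_in_setT card_edges_in cardsT card_ord.

pose w := widen_ord (ltnW mn).
have w_inj : injective w by move=> i j /(congr1 val) /= /val_inj.
pose A := w @: setT.
have Am : #|A| = m by rewrite card_imset // cardsT card_ord.
have [G sub [fG sG]] := saturated_supergraph (clique_free_meeting w_inj (erefl A) nf).
apply: leq_trans (satP G fG.1 sG) _; rewrite -Am; apply: card_graph_le fG.1 _ => v vA.
rewrite -(leq_add2r (m.+1 - k.-1)); apply: leq_trans degD.
exact: outer_degree_le (ltnW k1) Am fm sub fG vA.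
Qed.

(** * Thresholds *)

(* If no clique on [ord0] and a triple is rainbow, every triple splits as
   [a |: g] with [g] an edge of the colour of [ord0 a]; each of the 6 vertices [a]
   admits at most 2 such disjoint edges [g], fewer than the 20 triples. *)
Lemma forces_rainbow_7_4 : forces_rainbow 7 4.
Proof.
move=> C c pc; apply: contrapT => none.
pose S : {set 'I_7} := ~: [set ord0].
have cS : #|S| = 6 by rewrite cardsC1 card_ord.
pose P a : {set {set 'I_7}} :=
  [set g in edges_in (S :\ a) | `[< c [set ord0; a] = c g >]].
have cP a : a \in S -> #|P a| <= 2.
  move=> aS; have triv : trivIset (P a).
    apply/trivIsetP => g h; rewrite !inE.
    move=> /andP[/andP[g2 _] /asboolP cg] /andP[/andP[h2 _] /asboolP ch] gh.
    by apply: (proper_disjoint pc); rewrite ?inE // -cg.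
  have : #|cover (P a)| <= 5.
    have S5 : #|S :\ a| <= 5 by have := cardsD1 a S; rewrite aS cS; lia.
    apply: leq_trans S5; apply: subset_leq_card; apply/bigcupsP => g.
    by rewrite inE edges_inE => /andP[/andP[]].
  rewrite -(eqP triv) (eq_bigr (fun=> 2)); last first.
    by move=> g; rewrite inE edges_inE => /andP[/andP[/eqP]].
  by rewrite sum_nat_const; lia.
pose T := [set X : {set 'I_7} | X \subset S & #|X| == 3].
pose N := [set p : 'I_7 * {set 'I_7} | (p.1 \in S) && (p.2 \in P p.1)].
have cN : #|N| <= 12.
  rewrite -sum1_card (eq_bigl (fun p : 'I_7 * {set 'I_7} => (p.1 \in S) && (p.2 \in P p.1))); last first.
    by move=> p; rewrite inE.
  rewrite -(pair_big_dep (fun a => a \in S) (fun a g => g \in P a) (fun _ _ => 1)) /=.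
  apply: (@leq_trans (\sum_(a in S) 2)); last by rewrite sum_nat_const cS.
  by apply: leq_sum => a aS; rewrite sum1_card cP.
have : #|T| <= #|N|.
  apply: (leq_card_rel (r := fun X p => X = p.1 |: p.2)); last by move=> ? ? ? _ _ -> ->.
  move=> X; rewrite inE => /andP[XS X3].
  have oX : ord0 \notin X by apply: contraL (XS) => oX; apply/subsetPn; exists ord0; rewrite // !inE.
  have X4 : #|ord0 |: X| = 4 by rewrite cardsU1 oX (eqP X3).
  have [|e [f [eX fX ef cef]]] := not_rainbow (G := edges_in (ord0 |: X)) (c := c).
    by move=> rb; apply: none; exists (ord0 |: X).
  have eK : e \in complete_graph 'I_7 by move: eX; rewrite !inE => /andP[].
  have fK : f \in complete_graph 'I_7 by move: fX; rewrite !inE => /andP[].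
  have d := proper_disjoint pc eK fK ef cef.
  move: eX fX; rewrite !edges_inE => /andP[/eqP e2 eX] /andP[/eqP f2 fX].
  have efX : e :|: f = ord0 |: X.
    apply/eqP; rewrite eqEcard subUset eX fX X4 cardsU (disjoint_setI0 d).
    by rewrite cards0 e2 f2.
  wlog oe : e f e2 f2 eX fX ef cef eK fK d efX / ord0 \in e.
    move=> H; have : ord0 \in e :|: f by rewrite efX setU11.
    case/setUP => [oe|of_]; first exact: (H e f).
    by apply: (H f e); rewrite // 1?disjoint_sym // 1?eq_sym // setUC.
  have [a ao eE] := edge_cons e2 oe.
  have fo : ord0 \notin f by rewrite (disjointFr d oe).
  have fa : a \notin f by rewrite (disjointFr d) // eE set22.
  have XE : X = a |: f.
    have : (e :|: f) :\ ord0 = X by rewrite efX setU1K.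
    move <-; rewrite eE -setUA setU1K //.
    by rewrite !inE negb_or eq_sym ao fo.
  exists (a, f); last exact: XE.
  have aS : a \in S by rewrite !inE.
  rewrite inE /= aS; apply/setIdP; split; last by apply/asboolP; rewrite -eE.
  rewrite edges_inE f2 eqxx subsetD1 fa andbT.
  by apply: subset_trans XS; rewrite XE subsetUr.
rewrite cards_draws cS => h; have := leq_trans h cN.
by rewrite (_ : 'C(6, 3) = 20).
Qed.

(* The five-colour 1-factorization of [K_6]: [{x, y}] gets [x + y] modulo 5 and
   [{x, 5}] gets [2 x].  A rainbow [K_4] would need six colours. *)
Lemma not_forces_rainbow_6_4 : ~ forces_rainbow 6 4.
Proof.
(* The colours on natural numbers, so that properness becomes a finite computation; in [c] the
   vertex 5 is [ord_max]. *)
pose col (x y : nat) := (if x == 5 then 2 * y else if y == 5 then 2 * x else x + y) %% 5.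
pose c (e : {set 'I_6}) : 'I_5 :=
  inZp (if ord_max \in e then 2 * \sum_(i in e :\ ord_max) i else \sum_(i in e) i).
have cE (x y : 'I_6) : x != y -> c [set x; y] = col x y :> nat.
  move=> xy; rewrite /c /col /=; congr (_ %% 5).
  have e5 (z : 'I_6) : (z == 5 :> nat) = (z == ord_max) by rewrite -val_eqE.
  rewrite !inE !e5 !(eq_sym ord_max); have [xm|xm] := eqVneq x ord_max.
    rewrite xm setU1K ?big_set1 // inE -xm //.
  have [ym|ym] := eqVneq y ord_max.
    by rewrite ym setUC setU1K ?big_set1 // inE eq_sym.
  by rewrite big_setU1 ?big_set1 //= inE.
have col_neq (x y z : 'I_6) : x != y -> x != z -> y != z -> col x y != col x z.
  have : all (fun x => all (fun y => all (fun z =>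
     [&& x != y, x != z & y != z] ==> (col x y != col x z)) (iota 0 6)) (iota 0 6)) (iota 0 6).
    by vm_compute.
  move=> /allP/(_ x); rewrite mem_iota ltn_ord => /(_ isT).
  move=> /allP/(_ y); rewrite mem_iota ltn_ord => /(_ isT).
  move=> /allP/(_ z); rewrite mem_iota ltn_ord => /(_ isT).
  by rewrite -!val_eqE /= => + xy xz yz; rewrite xy xz yz.
move=> /(_ _ c)[|Q Q4 rb].
  move=> e f; rewrite !inE => /eqP e2 /eqP f2 ef /pred0Pn[x /andP[/= xe xf]].
  have [y yx eE] := edge_cons e2 xe; have [z zx fE] := edge_cons f2 xf.
  move=> /(congr1 (@nat_of_ord 5)); rewrite eE fE !cE ?(eq_sym x) //.
  apply/eqP; apply: col_neq; rewrite 1?eq_sym //.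
  by apply: contraNneq ef => yz; rewrite eE fE yz.
have := card_in_imset rb; rewrite card_edges_in Q4 => c6.
by have := max_card (mem (c @: edges_in Q)); rewrite c6 card_ord.
Qed.

(** Take the conflicts of a colouring without a rainbow [K_j]: an independent set larger than [j]
    would contain such a clique. *)
Lemma not_forces_rainbow_independent (m j k : nat) : j <= k -> ~ forces_rainbow m j ->
  exists E : {set {set 'I_m}}, [/\ forall e, e \in E -> #|e| = 4,
    forall T : {set 'I_m}, #|T| = 3 -> #|[set e in E | T \subset e]| <= 3 &
    forall W, independent E W -> #|W| <= k].
Proof.
move=> jk /existsNP[C /existsNP[c /not_implyP[pc none]]].
exists (conflicts c); split.
- exact: card_conflict.
- exact: conflict_codegree.
move=> W iW; apply: leq_trans jk; rewrite leqNgt; apply/negP => jW.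
have /card_geqP[s [us ss sub_s]] := ltnW jW.
apply: none; exists [set x in s]; first by rewrite cardsE (card_uniqP us).
apply: rainbowS (rainbow_independent pc iW); apply: edges_inS.
by apply/subsetP => x; rewrite inE => /sub_s.
Qed.

(** Failure occurs at 0, as [j > 0], and by the cube bound only up to [k ^ 3], so there is a largest
    failing [m]. *)
Lemma forcing_threshold (j k : nat) : 0 < j <= k ->
  exists m, ~ forces_rainbow m j /\ forces_rainbow m.+1 j.
Proof.
move=> /andP[j0 jk]; pose p m := `[< ~ forces_rainbow m j >].
have p0 : exists m, p m.
  exists 0; apply/asboolP => /(_ _ id)[e f|Q Qj _].
    move=> + _ _ /pred0Pn[[x]] //.
  by have := max_card (mem Q); rewrite card_ord Qj leqNgt j0.
have pk m : p m -> m <= k ^ 3.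
  move=> /asboolP /(not_forces_rainbow_independent jk)[E [c4 c3 hW]].
  rewrite -[X in X <= _]card_ord; apply: (order_le_cube c4 c3) hW.
  exact: leq_trans j0 jk.
case: (ex_maxnP p0 pk) => m /asboolP nf maxm; exists m; split=> //.
by apply: contrapT => /asboolP /maxm; rewrite ltnn.
Qed.

(** * Both bounds on the saturation numbers of cliques *)

Local Open Scope ring_scope.

Theorem theorem1p1 (R : realType) :
  (exists C : R, forall k n : nat, (4 <= k)%N -> (6 <= n)%N ->
     (rainbow_sat n (complete_graph 'I_k))%:R
       <= (1 / 4 + C / ln (k%:R : R)) * k%:R ^+ 3 * n%:R) /\
  (forall n : nat, (6 <= n)%N ->
     (rainbow_sat n (complete_graph 'I_5) <= (21 * n) %/ 2 - 48)%N).
Proof.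
split; last first.
  move=> n n6.
  (* [4 * 'C(3, 2) = 12 = 9 + (7 - 4)], and [15 + 6 * (n - 6) + (9 * (n - 6))./2] is the claimed
     value. *)
  have := @rainbow_sat_clique_le n 5 6 9 isT not_forces_rainbow_6_4 forces_rainbow_7_4 isT.
  rewrite (minn_idPl n6) => /leq_trans; apply.
  rewrite (_ : 'C(6, 2) = 15)%N // divn2; lia.
(* The constant serves twice: for ln k up to it the cube bound on [m] suffices, and beyond it 2304
   is replaced by it. *)
exists (10 ^+ 9) => k n k4 n6.
have jk : (0 < k.-1 <= k)%N by lia.
have [m [nf fm]] := forcing_threshold jk.
have [E [c4 c3 hW]] := not_forces_rainbow_independent (leq_pred k) nf.
have k0 : (0 < k)%N by lia.
have := order_le_cube c4 c3 k0 hW; rewrite card_ord => mk.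
have := @order_le_cube_div_ln _ _ c4 c3 R k; rewrite card_ord => mln.
have k_gt1 : (1 < k)%N by lia.
have := rainbow_sat_clique_le n k_gt1 nf fm (leq_addr _ _).
set D := (k.-1 * 'C(k.-2, 2))%N; set s := rainbow_sat _ _ => s_le.
have bin2_le x : (2 * 'C(x, 2) <= x * x)%N.
  rewrite bin2 mul2n; apply: (@leq_trans (x * x.-1)); last first.
    by rewrite leq_mul2l leq_pred orbT.
  by rewrite -[leqRHS]odd_double_half leq_addl.
(* The outer edges, at most [D * n / 2], thus number at most [k ^ 3 * n / 4]: this is the
   coefficient 1/4. *)
have D_le : (2 * D <= k ^ 3)%N.
  rewrite mulnCA !expnS expn0 muln1; apply: leq_mul; first exact: leq_pred.
  by apply: leq_trans (bin2_le _) _; apply: leq_mul; rewrite -subn2 leq_subr.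
have s_le' : (4 * s <= (4 * m + k ^ 3) * n)%N.
  move: s_le; set a := minn m n => s_le.
  have [am an] : (a <= m /\ a <= n)%N by rewrite geq_minl geq_minr.
  have b1 := bin2_le a.
  have b2 : (2 * D * (n - a) <= k ^ 3 * n)%N by apply: leq_mul; rewrite ?leq_subr.
  have b3 : (2 * (D * (n - a))./2 <= D * (n - a))%N.
    by rewrite mul2n -[leqRHS]odd_double_half leq_addl.
  have b4 : (a * (n - a) + a * a = a * n)%N by rewrite -mulnDr subnK.
  have b5 : (a * n <= m * n)%N by rewrite leq_mul2r am orbT.
  rewrite mulnDl -mulnA; rewrite -mulnA in b2; lia.
have k3 : 1 <= k%:R ^+ 3 :> R by rewrite exprn_ege1 // ler1n.
set t := ln (k%:R : R) in mln *.
have t0 : 0 < t by rewrite ln_gt0 // ltr1n.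
have n0 : 0 <= n%:R :> R by rewrite ler0n.
suff m_le : m%:R <= 10 ^+ 9 / t * k%:R ^+ 3.
  have : (4 * s%:R : R) <= (4 * m%:R + k%:R ^+ 3) * n%:R.
    by rewrite -natrX -!natrM -natrD -natrM ler_nat.
  have := ler_wpM2r n0 m_le; lra.
have [t_small|t_big] := leP t (10 ^+ 9).
  apply: (@le_trans _ _ (k%:R ^+ 3)); first by rewrite -natrX ler_nat.
  by rewrite ler_peMl // ?ler_pdivlMr ?mul1r //; lra.
apply: le_trans (mln (ltW t_big) hW) _.
apply: ler_wpM2r; first lra.
apply: ler_wpM2r; first by rewrite invr_ge0 ltW.
lra.
Qed.
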